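(* Let $\mathcal A$ be a net of local observables satisfying the Haag–Kastler axioms and Haag duality, whose locally generated superselection sectors with finite statistics are labelled by $\mathcal I_{\mathcal A}$ and have fusion rules $N^{IJ}_K$. If the theory defined by $\mathcal A$ is rational, i.e. has only a finite number of superselection sectors, then there exists a semisimple bi-$*$-algebra $\mathcal G^*$ with antipode such that the multiplicities in its Clebsch–Gordon decomposition agree with the fusion rules: there is a bijection between $\mathcal I_{\mathcal A}$ and the set of equivalence classes of finite-dimensional irreducible representations of $\mathcal G^*$, and unitary representatives $\tau^J$ ($J\in\mathcal I_{\mathcal A}$) of these classes, such that $$\dim\mathcal C(\tau^I\boxtimes\tau^J|\tau^K)=N^{IJ}_K\qquad\text{for all }I,J,K\in\mathcal I_{\mathcal A}.$$
   Context: **Haag–Kastler net.** $M_d$ is $d$-dimensional Minkowski space, $\mathcal K$ the set of open double cones, $\mathcal S'$ the causal complement of $\mathcal S$; if $d=2$, $\mathcal O'$ has two components $\mathcal O_<,\mathcal O_>$ and $\mathcal O_1>\mathcal O$ means $\mathcal O_1\subset\mathcal O_>$; if $d>2$, $\mathcal O_1>\mathcal O$ means spacelike separation. $G$ is a group of causal transformations containing the translations. The net is a family of von Neumann algebras $\mathcal A(\mathcal O)\subset\mathcal B(\mathcal H^0)$, $\mathcal O\in\mathcal K$, with: (i) isotony; (ii) $\mathcal A(\mathcal O_1)\subset\mathcal A(\mathcal O_2)'$ (commutant) if $\mathcal O_1\subset\mathcal O_2'$; (iii) a strongly continuous unitary representation $U_0$ of $G$ on $\mathcal H^0$ implementing $\alpha_g=\mathrm{Ad}\,U_0(g):\mathcal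 A(\mathcal O)\to\mathcal A(g\mathcal O)$, with translation spectrum in the closed forward light cone; (iv) a vector $|0\rangle\in\mathcal H^0$, unique up to a phase, invariant under $U_0$ and cyclic for each $\mathcal A(\mathcal O)$. $\mathcal A$ also denotes the norm closure of $\bigcup_{\mathcal O}\mathcal A(\mathcal O)$, $\pi_0$ its vacuum representation. *Haag duality*: $\mathcal A(\mathcal O)=\mathcal A(\mathcal O')'$, where $\mathcal A(\mathcal O')$ is the $C^*$-algebra generated by all $\mathcal A(\mathcal O_1)$, $\mathcal O_1\subset\mathcal O'$. **Sectors and fusion rules.** A ($G$-covariant, positive energy) representation $\pi$ of $\mathcal A$ is locally generated if $\pi|_{\mathcal A(\mathcal O')}\cong\pi_0|_{\mathcal A(\mathcal O')}$ for all $\mathcal O$; then $\pi\cong\pi_0\circ\rho$ with $\rho$ a localized transportable unital $*$-endomorphism of $\mathcal A$ (localized in $\mathcal O$: $\rho(A)=A$ for $A\in\mathcal A(\mathcal O_1)$, $\mathcal O_1\subset\mathcal O'$; transportable: for all $g\in G$ there is a unitarily equivalent one localized in $g\mathcal O$). $\mathcal T(\rho_1,\rho_2)=\{T\in\mathcal A\mid T\rho_1(A)=\rho_2(A)T\ \forall A\in\mathcal A\}$. The statistics operators $\varepsilon(\rho_1,\rho_2)\in\mathcal T(\rho_1\rho_2,\rho_2\rho_1)$ are the unique family of unitaries with $\varepsilon(\rho_1,\rho_2)\rho_1(T_2)T_1=T_2\sigma_2(T_1)\varepsilon(\sigma_1,\sigma_2)$ for $T_i\in\mathcal T(\sigma_i,\rho_i)$,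 $\varepsilon(\rho_1\rho_2,\sigma)=\varepsilon(\rho_1,\sigma)\rho_1(\varepsilon(\rho_2,\sigma))$, $\varepsilon(\sigma,\rho_1\rho_2)=\rho_1(\varepsilon(\sigma,\rho_2))\varepsilon(\sigma,\rho_1)$, and $\varepsilon(\rho_1,\rho_2)=1$ if $\rho_i$ is localized in $\mathcal O_i$ with $\mathcal O_1>\mathcal O_2$. An irreducible $\rho$ has finite statistics if it has a left inverse $\Phi$ (positive linear, $\Phi(1)=1$, $\Phi(\rho(A)B\rho(C))=A\Phi(B)C$) with $\Phi(\varepsilon(\rho,\rho))\ne0$. $\mathcal I_{\mathcal A}$ labels the equivalence classes $[\rho_J]$ of irreducible locally generated sectors with finite statistics; $N^{IJ}_K=\dim\mathcal T(\rho_I\circ\rho_J,\rho_K)$. **Bi-$*$-algebra with antipode.** An associative unital $*$-algebra $\mathcal G^*$ (unit $e$) with $*$-homomorphisms $\Delta:\mathcal G^*\to\mathcal G^*\otimes\mathcal G^*$ (with $(\xi\otimes\eta)^*=\xi^*\otimes\eta^*$; $\Delta(e)\neq e\otimes e$ is permitted) and $\epsilon:\mathcal G^*\to\mathbb C$ satisfying $(\epsilon\otimes id)\Delta=id=(id\otimes\epsilon)\Delta$, and a $\mathbb C$-linear anti-automorphism $\mathcal S$ with fixed elements $\alpha,\beta\in\mathcal G^*$ such that, for $\Delta(\xi)=\sum_\sigma\xi^1_\sigma\otimes\xi^2_\sigma$, $\sum\mathcal S(\xi^1_\sigma)\alpha\xi^2_\sigma=\alpha\epsilon(\xi)$, $\sum\xi^1_\sigma\beta\mathcal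 S(\xi^2_\sigma)=\beta\epsilon(\xi)$, $\mathcal S(\xi)^*=\mathcal S^{-1}(\xi^* )$, $\beta=\mathcal S(\alpha^* )$. Semisimple: $\mathcal G^*$ is a sum of full matrix algebras. A representation $\tau$ on a Hilbert space is unitary if $\tau(\xi^* )=\tau(\xi)^*$; $(\tau\boxtimes\tau')(\xi)=(\tau\otimes\tau')(\Delta(\xi))$; $\mathcal C(\tau\boxtimes\tau'|\tau'')$ is the space of linear maps $C:V\otimes V'\to V''$ with $C(\tau\boxtimes\tau')(\xi)=\tau''(\xi)C$ for all $\xi\in\mathcal G^*$. *)

(* Defs.v *)
From HB Require Import structures.
From mathcomp Require Import all_boot all_order all_algebra.
From mathcomp Require Import sesquilinear spectral.
From mathcomp Require Import complex mxtens.
From mathcomp Require Import all_classical all_reals all_analysis.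

Set Implicit Arguments.
Unset Strict Implicit.
Unset Printing Implicit Defensive.

Import Order.TTheory GRing.Theory Num.Theory.
Import numFieldNormedType.Exports.

Local Open Scope classical_set_scope.
Local Open Scope ring_scope.
Local Open Scope sesquilinear_scope.

Definition has_dim (C : fieldType) (V : lmodType C) (S : set V) (k : nat) :
    Prop :=
  exists2 b : 'I_k -> V, (forall i, S (b i)) &
    forall v, S v -> exists! c : {ffun 'I_k -> C}, v = \sum_i c i *: b i.

(* The dimension is d = n.+2; coordinate ord0 is time, and c = 1. *)
Notation minkowski R n := 'rV[R]_n.+2.

Section Minkowski.
Variables (R : realType) (n : nat).
Local Notation M := (minkowski R n).

Definition lorentz (x y : M) : R :=
  x 0 ord0 * y 0 ord0 - \sum_(i < n.+1) x 0 (lift ord0 i) * y 0 (lift ord0 i).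

Definition chronological (x y : M) : Prop :=
  0 < (y - x) 0 ord0 /\ 0 < lorentz (y - x) (y - x).

Definition spacelike (x y : M) : Prop := lorentz (x - y) (x - y) < 0.

Definition closed_forward_cone : set M :=
  [set p : M | 0 <= p 0 ord0 /\ 0 <= lorentz p p].

Definition double_cone (O : set M) : Prop :=
  exists x y : M, chronological x y /\
    O = [set z | chronological x z /\ chronological z y].

Definition causal_complement (S : set M) : set M :=
  [set x | forall y, S y -> spacelike x y].

(* For n = 0 (dimension two), ord_max is the only space coordinate, and this is
   the right-hand component of the causal complement. *)
Definition right_complement (O : set M) : set M :=
  [set x : M | forall y : M, O y ->
     `|x 0 ord0 - y 0 ord0| < x 0 ord_max - y 0 ord_max].

Definition dc_gt (O1 O : set M) : Prop :=
  if n == 0%N then O1 `<=` right_complement O else O1 `<=` causal_complement O.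

Definition translation (a : M) : M -> M := fun x => x + a.

Definition causal_transformation (g : M -> M) : Prop :=
  bijective g /\
  forall x y, chronological x y <-> chronological (g x) (g y).

Definition causal_group (G : set (M -> M)) : Prop :=
  [/\ G `<=` causal_transformation,
      forall a, G (translation a),
      forall g h, G g -> G h -> G (g \o h) &
      forall g, G g -> exists h, [/\ G h, cancel g h & cancel h g]].

End Minkowski.

(* hdot is linear in its first and conjugate-linear in its second argument. *)
Record hilbert (R : realType) := Hilbert {
  hsort :> completeNormedModType R[i];
  hdot : {dot hsort for (@Num.conj R[i])};
  hdotE : forall x : hsort, `|x| ^+ 2 = hdot x x }.
Arguments hdot {R h}.

Section Operators.
Variable R : realType.
Implicit Types H K : hilbert R.
Local Notation C := R[i].

Definition bounded_op H K (a : H -> K) : Prop := linear a /\ continuous a.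

Definition is_adjoint H (a b : H -> H) : Prop :=
  forall x y, hdot (a x) y = hdot x (b y).

Definition positive_op H (a : H -> H) : Prop := forall x, 0 <= hdot (a x) x.

Definition unitary_op H K (V : H -> K) : Prop :=
  [/\ linear V, forall x y, hdot (V x) (V y) = hdot x y &
      forall y, exists x, V x = y].

Definition commutant H (S : set (H -> H)) : set (H -> H) :=
  [set b | bounded_op b /\ forall a, S a -> a \o b = b \o a].

Definition adjoint_closed H (S : set (H -> H)) : Prop :=
  forall a, S a -> exists2 b, S b & is_adjoint a b.

Definition von_neumann_algebra H (S : set (H -> H)) : Prop :=
  [/\ S `<=` @bounded_op H H, adjoint_closed S &
      commutant (commutant S) = S].

Definition norm_closure H (S : set (H -> H)) : set (H -> H) :=
  [set a | bounded_op a /\ forall e : C, 0 < e ->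
     exists2 b, S b & forall x, `|a x - b x| <= e * `|x|].

Definition cstar_algebra H (S : set (H -> H)) : Prop :=
  [/\ S `<=` @bounded_op H H /\ norm_closure S `<=` S,
      S idfun,
      forall (k : C) a b, S a -> S b -> S (k *: a + b),
      forall a b, S a -> S b -> S (a \o b) &
      adjoint_closed S].

Definition cstar_generated H (S : set (H -> H)) : set (H -> H) :=
  [set a | forall B, cstar_algebra B -> S `<=` B -> B a].

Definition representation H (A : set (H -> H)) K
    (pi : (H -> H) -> (K -> K)) : Prop :=
  [/\ forall a, A a -> bounded_op (pi a),
      pi idfun = idfun,
      forall (k : C) a b, A a -> A b -> pi (k *: a + b) = k *: pi a + pi b,
      forall a b, A a -> A b -> pi (a \o b) = pi a \o pi b &
      forall a b, A a -> A b -> is_adjoint a b -> is_adjoint (pi a) (pi b)].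

Definition rep_equiv H (A : set (H -> H)) K1 K2
    (pi1 : (H -> H) -> (K1 -> K1)) (pi2 : (H -> H) -> (K2 -> K2)) : Prop :=
  exists2 V : K1 -> K2, unitary_op V &
    forall a, A a -> V \o pi1 a = pi2 a \o V.

Definition rep_irreducible H (A : set (H -> H)) K
    (pi : (H -> H) -> (K -> K)) : Prop :=
  (exists x : K, x != 0) /\
  forall W : set K, W 0 -> (forall (k : C) x y, W x -> W y -> W (k *: x + y)) ->
    closed W -> (forall a x, A a -> W x -> W (pi a x)) ->
    W = [set 0] \/ W = setT.

End Operators.

Section Covariance.
Variables (R : realType) (n : nat).
Local Notation M := (minkowski R n).

(* G carries the compact-open topology of a group of maps M -> M; continuity is
   that of g |-> U g x for every vector x. *)
Definition unitary_rep (G : set (M -> M)) (K : hilbert R)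
    (U : (M -> M) -> K -> K) : Prop :=
  [/\ forall g, G g -> unitary_op (U g),
      U idfun = idfun,
      forall g h, G g -> G h -> U (g \o h) = U g \o U h &
      forall x, {within (G : set {compact-open, M -> M}),
        continuous (fun g : {compact-open, M -> M} => U g x)}].

Local Notation borelM := (g_sigma_algebraType (@open M)).

(* The spectral resolution U(a) = \int exp(i p.a) dE(p) of the translations,
   with p.a the Lorentz product; E is projection-valued, mu x is the measure
   <x, E(.) x>, and the spectrum (the support of E) lies in the closed forward
   cone iff E vanishes on its complement. *)
Definition positive_energy (K : hilbert R) (U : (M -> M) -> K -> K) : Prop :=
  exists (E : set M -> K -> K)
         (mu : K -> {finite_measure set borelM -> \bar R}),
  [/\ forall B : set borelM, measurable B ->
        [/\ bounded_op (E B), E B \o E B = E B & is_adjoint (E B) (E B)],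
      E setT = idfun,
      forall (x : K) (B : set borelM), measurable B ->
        hdot (E B x) x = (fine (mu x B))%:C%C,
      forall (x : K) (a : M),
        hdot (U (translation a) x) x =
          Complex (Rintegral (mu x) setT (fun p => cos (lorentz p a)))
                  (Rintegral (mu x) setT (fun p => sin (lorentz p a))) &
      forall x, E (~` @closed_forward_cone R n) x = 0].

End Covariance.

Section Net.
Variables (R : realType) (n : nat).
Local Notation M := (minkowski R n).

Definition observables H (A : set M -> set (hsort H -> hsort H)) :
    set (hsort H -> hsort H) :=
  @norm_closure R H
    (\bigcup_(O in [set O | double_cone O]) A O).

Definition region_algebra H (A : set M -> set (hsort H -> hsort H))
    (S : set M) : set (hsort H -> hsort H) :=
  @cstar_generated R H
    (\bigcup_(O in [set O | double_cone O /\ O `<=` S]) A O).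

Record haag_kastler := HaagKastler {
  hk_space : hilbert R;
  hk_group : set (M -> M);
  hk_net : set M -> set (hk_space -> hk_space);
  hk_rep : (M -> M) -> hk_space -> hk_space;
  hk_vacuum : hk_space;
  hk_group_causal : causal_group hk_group;
  hk_vN : forall O, double_cone O -> von_neumann_algebra (hk_net O);
  hk_isotony : forall O1 O2, double_cone O1 -> double_cone O2 ->
    O1 `<=` O2 -> hk_net O1 `<=` hk_net O2;
  hk_locality : forall O1 O2, double_cone O1 -> double_cone O2 ->
    O1 `<=` causal_complement O2 -> hk_net O1 `<=` commutant (hk_net O2);
  hk_rep_unitary : unitary_rep hk_group hk_rep;
  hk_covariance : forall g O a, hk_group g -> double_cone O -> hk_net O a ->
    exists2 b, hk_net (g @` O) b & hk_rep g \o a = b \o hk_rep g;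
  hk_spectrum : positive_energy hk_rep;
  hk_vacuum_unit : `|hk_vacuum| = 1;
  hk_vacuum_inv : forall g, hk_group g -> hk_rep g hk_vacuum = hk_vacuum;
  hk_vacuum_unique : forall x, `|x| = 1 ->
    (forall g, hk_group g -> hk_rep g x = x) ->
    exists2 z : R[i], `|z| = 1 & x = z *: hk_vacuum;
  hk_vacuum_cyclic : forall O, double_cone O ->
    closure [set a hk_vacuum | a in hk_net O] = setT }.

Arguments hk_net : clear implicits.
Arguments hk_rep : clear implicits.

Variable A : haag_kastler.
Local Notation H := (hk_space A).
Local Notation BH := (hsort H -> hsort H).
Local Notation obs := (observables (hk_net A)).
Local Notation region := (region_algebra (hk_net A)).

Definition haag_duality : Prop :=
  forall O, double_cone O ->
    hk_net A O = commutant (region (causal_complement O)).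

(* The relation hk_rep g \o a = b \o hk_rep g says that b = alpha_g(a). *)
Definition covariant_positive_energy (K : hilbert R) (pi : BH -> K -> K) :
    Prop :=
  exists U : (M -> M) -> K -> K,
    [/\ unitary_rep (hk_group A) U, positive_energy U &
        forall g a b, hk_group A g -> obs a -> obs b ->
          hk_rep A g \o a = b \o hk_rep A g -> U g \o pi a = pi b \o U g].

(* The vacuum representation is the identity map of BH. *)
Definition locally_generated (K : hilbert R) (pi : BH -> K -> K) : Prop :=
  [/\ representation obs pi, covariant_positive_energy pi &
      forall O, double_cone O ->
        rep_equiv (region (causal_complement O)) pi (idfun : BH -> BH)].

(* Only the values of an endomorphism on obs are relevant. *)
Definition endomorphism (rho : BH -> BH) : Prop :=
  representation obs rho /\ forall a, obs a -> obs (rho a).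

Definition localized (rho : BH -> BH) (O : set M) : Prop :=
  forall O1 a, double_cone O1 -> O1 `<=` causal_complement O ->
    hk_net A O1 a -> rho a = a.

Definition localized_transportable (rho : BH -> BH) : Prop :=
  endomorphism rho /\
  exists O, [/\ double_cone O, localized rho O &
    forall g, hk_group A g -> exists rho',
      [/\ endomorphism rho', localized rho' (g @` O) & rep_equiv obs rho rho']].

Definition intertwiners (rho1 rho2 : BH -> BH) : set BH :=
  [set t | obs t /\ forall a, obs a -> t \o rho1 a = rho2 a \o t].

Definition statistics_operators (eps : (BH -> BH) -> (BH -> BH) -> BH) : Prop :=
  let LT := localized_transportable in
  [/\ forall r1 r2, LT r1 -> LT r2 ->
        unitary_op (eps r1 r2) /\
        intertwiners (r1 \o r2) (r2 \o r1) (eps r1 r2),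
      forall r1 r2 s1 s2 t1 t2, LT r1 -> LT r2 -> LT s1 -> LT s2 ->
        intertwiners s1 r1 t1 -> intertwiners s2 r2 t2 ->
        eps r1 r2 \o r1 t2 \o t1 = t2 \o s2 t1 \o eps s1 s2,
      forall r1 r2 s, LT r1 -> LT r2 -> LT s ->
        eps (r1 \o r2) s = eps r1 s \o r1 (eps r2 s),
      forall r1 r2 s, LT r1 -> LT r2 -> LT s ->
        eps s (r1 \o r2) = r1 (eps s r2) \o eps s r1 &
      forall r1 r2 O1 O2, LT r1 -> LT r2 -> double_cone O1 -> double_cone O2 ->
        localized r1 O1 -> localized r2 O2 -> dc_gt O1 O2 ->
        eps r1 r2 = idfun].

Definition left_inverse (rho Phi : BH -> BH) : Prop :=
  [/\ forall a, obs a -> obs (Phi a),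
      forall (k : R[i]) a b, obs a -> obs b ->
        Phi (k *: a + b) = k *: Phi a + Phi b,
      forall a, obs a -> positive_op a -> positive_op (Phi a),
      Phi idfun = idfun &
      forall a b c, obs a -> obs b -> obs c ->
        Phi (rho a \o b \o rho c) = a \o Phi b \o c].

Definition finite_statistics (eps : (BH -> BH) -> (BH -> BH) -> BH)
    (rho : BH -> BH) : Prop :=
  exists2 Phi, left_inverse rho Phi & Phi (eps rho rho) <> 0.

Definition finite_sector (eps : (BH -> BH) -> (BH -> BH) -> BH)
    (rho : BH -> BH) : Prop :=
  [/\ localized_transportable rho, @locally_generated H rho,
      rep_irreducible obs rho & finite_statistics eps rho].

Definition sector_labelling (eps : (BH -> BH) -> (BH -> BH) -> BH)
    (I : Type) (rho : I -> BH -> BH) : Prop :=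
  [/\ forall J, finite_sector eps (rho J),
      forall J K, rep_equiv obs (rho J) (rho K) -> J = K &
      forall sigma, finite_sector eps sigma ->
        exists J, rep_equiv obs sigma (rho J)].

End Net.

(* Elements of the algebraic tensor product A (x) A are written as finite sums
   \sum a (x) b, encoded as lists of pairs; by the universal property two lists
   denote the same tensor iff all bilinear forms agree on them. *)
Definition tensor_eq (C : fieldType) (A : lmodType C) (s t : seq (A * A)) :
    Prop :=
  forall f : {biscalar A}, \sum_(p <- s) f p.1 p.2 = \sum_(p <- t) f p.1 p.2.

(* The product is a field because MathComp's algType excludes the zero algebra,
   which is an (empty) sum of full matrix algebras. *)
Record bistar_algebra (C : numClosedFieldType) := BistarAlgebra {
  bs_sort :> lmodType C;
  bs_mul : bs_sort -> bs_sort -> bs_sort;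
  bs_one : bs_sort;
  bs_star : bs_sort -> bs_sort;
  bs_Delta : bs_sort -> seq (bs_sort * bs_sort);
  bs_eps : bs_sort -> C;
  bs_S : bs_sort -> bs_sort;
  bs_Sinv : bs_sort -> bs_sort;
  bs_alpha : bs_sort;
  bs_beta : bs_sort;
  bs_mul_linearl : forall y, linear (bs_mul^~ y);
  bs_mul_linearr : forall x, linear (bs_mul x);
  bs_mulA : associative bs_mul;
  bs_mul1x : left_id bs_one bs_mul;
  bs_mulx1 : right_id bs_one bs_mul;
  bs_starK : involutive bs_star;
  bs_star_antilinear : forall (k : C) x y,
    bs_star (k *: x + y) = k^* *: bs_star x + bs_star y;
  bs_starM : forall x y, bs_star (bs_mul x y) = bs_mul (bs_star y) (bs_star x);
  bs_Delta_linear : forall (k : C) x y, tensor_eq (bs_Delta (k *: x + y))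
    ([seq (k *: p.1, p.2) | p <- bs_Delta x] ++ bs_Delta y);
  bs_DeltaM : forall x y, tensor_eq (bs_Delta (bs_mul x y))
    [seq (bs_mul p.1 q.1, bs_mul p.2 q.2) | p <- bs_Delta x, q <- bs_Delta y];
  bs_Delta_star : forall x, tensor_eq (bs_Delta (bs_star x))
    [seq (bs_star p.1, bs_star p.2) | p <- bs_Delta x];
  bs_eps_linear : scalar bs_eps;
  bs_epsM : forall x y, bs_eps (bs_mul x y) = bs_eps x * bs_eps y;
  bs_eps_star : forall x, bs_eps (bs_star x) = (bs_eps x)^*;
  bs_counitl : forall x, \sum_(p <- bs_Delta x) bs_eps p.1 *: p.2 = x;
  bs_counitr : forall x, \sum_(p <- bs_Delta x) bs_eps p.2 *: p.1 = x;
  bs_S_linear : linear bs_S;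
  bs_SM : forall x y, bs_S (bs_mul x y) = bs_mul (bs_S y) (bs_S x);
  bs_SK : cancel bs_S bs_Sinv;
  bs_SinvK : cancel bs_Sinv bs_S;
  bs_S_alpha : forall x,
    \sum_(p <- bs_Delta x) bs_mul (bs_mul (bs_S p.1) bs_alpha) p.2 =
      bs_eps x *: bs_alpha;
  bs_S_beta : forall x,
    \sum_(p <- bs_Delta x) bs_mul (bs_mul p.1 bs_beta) (bs_S p.2) =
      bs_eps x *: bs_beta;
  bs_S_star : forall x, bs_star (bs_S x) = bs_Sinv (bs_star x);
  bs_betaE : bs_beta = bs_S (bs_star bs_alpha) }.
Arguments bs_one {C} b.

Section BistarRepresentations.
Variables (C : numClosedFieldType) (A : bistar_algebra C).

Definition semisimple : Prop :=
  exists (k : nat) (m : 'I_k -> nat) (phi : A -> forall i, 'M[C]_(m i)),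
    [/\ forall i, (0 < m i)%N,
        bijective phi,
        forall i, linear (phi^~ i),
        forall i, phi (bs_one A) i = 1%:M &
        forall x y i, phi (bs_mul x y) i = phi x i *m phi y i].

(* Matrices act on column vectors. *)
Definition mx_rep m (tau : A -> 'M[C]_m) : Prop :=
  [/\ linear tau, tau (bs_one A) = 1%:M &
      forall x y, tau (bs_mul x y) = tau x *m tau y].

(* Invariant subspaces of column vectors are row spaces of U, transposed. *)
Definition mx_rep_irreducible m (tau : A -> 'M[C]_m) : Prop :=
  (0 < m)%N /\
  forall U : 'M[C]_m, (forall x, stablemx U (tau x)^T) ->
    \rank U = 0%N \/ \rank U = m.

Definition mx_rep_unitary m (tau : A -> 'M[C]_m) : Prop :=
  forall x, tau (bs_star x) = (tau x)^t*.

Definition mx_rep_equiv m m' (tau : A -> 'M[C]_m) (tau' : A -> 'M[C]_m') :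
    Prop :=
  exists (X : 'M[C]_(m', m)) (Y : 'M[C]_(m, m')),
    [/\ X *m Y = 1%:M, Y *m X = 1%:M & forall x, X *m tau x = tau' x *m X].

Definition boxtimes m m' (tau : A -> 'M[C]_m) (tau' : A -> 'M[C]_m') :
    A -> 'M[C]_(m * m') :=
  fun x => \sum_(p <- bs_Delta x) tau p.1 *t tau' p.2.

Definition clebsch_gordan m m' m'' (tau : A -> 'M[C]_m) (tau' : A -> 'M[C]_m')
    (tau'' : A -> 'M[C]_m'') : set 'M[C]_(m'', m * m') :=
  [set X | forall x, X *m boxtimes tau tau' x = tau'' x *m X].

End BistarRepresentations.

(* Main.v *)
(** Only two properties of the fusion rules are needed: they are finite, and the vacuum
    sector is a two-sided unit for them. Given this, let the algebra be a sum of full matrix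
    algebras, one block per sector, of size 1 for the vacuum and of one common large size
    for the others, and let the (J1, J2) component of the coproduct of x be the sum of
    [W x_K W^*] over K and over N^{J1 J2}_K isometries W with orthogonal ranges. The
    coproduct is not required to be unital, so the ranges need not fill the whole space.

    Finiteness: by Haag duality intertwiners are local, hence have adjoints among the
    observables. Normalized and mutually orthogonal intertwiners t_i from rho_I rho_J to
    rho_K give orthogonal projections t_i^* t_i. For a left inverse Phi of rho_I, Schur's
    lemma makes Phi (t_i^* t_i) a scalar; these scalars add up to at most 1, and naturality
    of the statistics operators bounds each of them below by a multiple of |lambda|^2,
    where lambda is the nonzero scalar Phi (eps (rho_I, rho_I)).

    Vacuum: an irreducible sector acts on the vacuum space through observables, so the
    observables themselves act irreducibly and the identity is one of the sectors. Without
    any sector, the zero algebra answers the question. *)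

Require Import Defs.
From HB Require Import structures.
From mathcomp Require Import all_boot all_order all_algebra.
From mathcomp Require Import sesquilinear spectral.
From mathcomp Require Import complex mxtens.
From mathcomp Require Import ring lra.
From mathcomp Require Import all_classical all_reals all_analysis.

Set Implicit Arguments.
Unset Strict Implicit.
Unset Printing Implicit Defensive.

Import Order.TTheory GRing.Theory Num.Theory.
Import numFieldNormedType.Exports.
Local Open Scope classical_set_scope.
Local Open Scope ring_scope.

(** * Bi-star-algebras with prescribed fusion rules *)

Local Open Scope sesquilinear_scope.

(** The finiteness step takes the form [N * |lambda|^2 <= 16]. Only positivity of [Phi] is
    available, so Cauchy-Schwarz is used for the functionals [hdot (Phi _ x) x], which see diagonal
    values alone. The operator to be estimated is [lambda] times an isometry, whose diagonal values
    might be small; polarization yields a vector of norm at most 2 where that of the isometry has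
    modulus at least 1, and this norm enters to the fourth power. A normalized orthogonal family of
    maximal length is then a basis: otherwise the remainder of some intertwiner could be normalized
    and appended. Schur's lemma rests on an operator square root, the limit of a norm-convergent
    iteration. It decides the sign of a self-adjoint operator in the commutant, with closed kernels
    in the role of spectral subspaces. On the algebraic side the counit is the character of the
    vacuum block. The counit axioms are equalities, so the components of the coproduct of [x] with
    one vacuum factor have to be the blocks of [x] themselves; the isometries are identity matrices
    there. *)

Lemma mx_commutant_scalar (F : fieldType) n (k : 'I_n) (A : 'M[F]_n) :
  (forall M, A *m M = M *m A) -> exists c, A = c%:M.
Proof.
move=> AM; exists (A k k); apply/matrixP => i j; rewrite mxE.
(* Entry [(i, k)] of [A *m delta_mx j k] is [A i j]; that of [delta_mx j k *m A] is [A k k] if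
   [i = j] and 0 otherwise. *)
have := congr1 (fun M : 'M[F]_n => M i k) (AM (delta_mx j k)); rewrite !mxE.
rewrite (bigD1 j) //= mxE !eqxx mulr1 big1 ?addr0 => [->|l /negPf lj].
  rewrite (bigD1 k) //= mxE eqxx andbT big1 ?addr0 => [|l /negPf lk].
    by rewrite mulr_natl.
  by rewrite mxE lk andbF mul0r.
by rewrite mxE lj mulr0.
Qed.

(** * Sums of full matrix algebras, and tensors over them *)

Section BlockAlgebra.
Variables (C : numClosedFieldType) (I : finType) (m : I -> nat).

(** Storing all entries in one finite function, rather than in a dependent family of matrices, gives
    the module structure at once and makes the matrix units a basis over a finite type. *)
Definition block_index : finType := {J : I & ('I_(m J) * 'I_(m J))%type}.
Definition block_alg := {ffun block_index -> C^o}.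
Implicit Types (x y : block_alg) (s t : seq (block_alg * block_alg)).

Definition block x J : 'M[C]_(m J) :=
  \matrix_(i, j) x (Tagged (fun J => ('I_(m J) * 'I_(m J))%type) (i, j)).

Definition of_blocks (F : forall J, 'M[C]_(m J)) : block_alg :=
  [ffun k => F (tag k) (tagged k).1 (tagged k).2].

Lemma of_blocksK F J : block (of_blocks F) J = F J.
Proof. by apply/matrixP => i j; rewrite !mxE ffunE. Qed.

Lemma block_inj x y : (forall J, block x J = block y J) -> x = y.
Proof.
move=> xy; apply/ffunP => -[J [i j]].
by have /matrixP/(_ i j) := xy J; rewrite !mxE.
Qed.

Lemma block_linear J : linear (block^~ J).
Proof. by move=> k x y; apply/matrixP => i j; rewrite !mxE !ffunE. Qed.

Lemma blockD J : {morph block^~ J : x y / x + y}.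
Proof. by move=> x y; apply/matrixP => i j; rewrite !mxE !ffunE. Qed.

Lemma blockZ J k x : block (k *: x) J = k *: block x J.
Proof. by apply/matrixP => i j; rewrite !mxE !ffunE. Qed.

Lemma block0 J : block 0 J = 0.
Proof. by apply/matrixP => i j; rewrite !mxE !ffunE. Qed.

Lemma block_sum J (T : Type) (r : seq T) (F : T -> block_alg) :
  block (\sum_(i <- r) F i) J = \sum_(i <- r) block (F i) J.
Proof. exact: (big_morph (block^~ J) (@blockD J) (@block0 J)). Qed.

Definition block_mul x y := of_blocks (fun J => block x J *m block y J).
Definition block_one := of_blocks (fun J => 1%:M).
Definition block_star x := of_blocks (fun J => (block x J)^t*).
Definition block_tr x := of_blocks (fun J => (block x J)^T).

Lemma blockM J x y : block (block_mul x y) J = block x J *m block y J.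
Proof. exact: of_blocksK. Qed.
Lemma block1 J : block block_one J = 1%:M.
Proof. exact: of_blocksK. Qed.
Lemma block_starE J x : block (block_star x) J = (block x J)^t*.
Proof. exact: of_blocksK. Qed.
Lemma block_trE J x : block (block_tr x) J = (block x J)^T.
Proof. exact: of_blocksK. Qed.

Definition tensor_block J1 J2 s : 'M[C]_(m J1 * m J2) :=
  \sum_(p <- s) block p.1 J1 *t block p.2 J2.

Definition block_basis (k : block_index) : block_alg := [ffun l => (l == k)%:R].

Lemma block_basis_sum x : x = \sum_k x k *: block_basis k.
Proof.
apply/ffunP => l; rewrite sum_ffunE (bigD1 l) //= big1 => [|k kl].
  by rewrite !ffunE eqxx addr0; rewrite /GRing.scale /= mulr1.
by rewrite !ffunE eq_sym (negPf kl) scaler0.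
Qed.

Lemma tensor_blockE J1 J2 s i1 j1 i2 j2 :
  tensor_block J1 J2 s (mxtens_index (i1, i2)) (mxtens_index (j1, j2)) =
  \sum_(p <- s) p.1 (Tagged (fun J => ('I_(m J) * 'I_(m J))%type) (i1, j1)) *
                p.2 (Tagged (fun J => ('I_(m J) * 'I_(m J))%type) (i2, j2)).
Proof. by rewrite summxE; apply: eq_bigr => p _; rewrite tensmxE !mxE. Qed.

(** A bilinear form is determined by its values on pairs of basis elements, and the coefficients of
    these values are the entries of the tensor blocks. The coproduct axioms thereby become matrix
    identities. *)
Lemma tensor_eq_blocks s t :
  (forall J1 J2, tensor_block J1 J2 s = tensor_block J1 J2 t) -> tensor_eq s t.
Proof.
move=> st f.
have E r : \sum_(p <- r) f p.1 p.2 = \sum_k \sum_l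
    (\sum_(p <- r) p.1 k * p.2 l) * f (block_basis k) (block_basis l).
  transitivity (\sum_(p <- r) \sum_k \sum_l
      (p.1 k * p.2 l) * f (block_basis k) (block_basis l)).
    apply: eq_bigr => p _; rewrite {1}[p.1]block_basis_sum linear_sumlz.
    apply: eq_bigr => k _; rewrite linearZl_LR /= {1}[p.2]block_basis_sum.
    rewrite linear_sumr mulr_sumr; apply: eq_bigr => l _.
    by rewrite linearZr_LR /= mulrA.
  rewrite exchange_big; apply: eq_bigr => k _.
  by rewrite exchange_big; apply: eq_bigr => l _; rewrite mulr_suml.
rewrite !{}E; apply: eq_bigr => -[J1 [i1 j1]] _.
apply: eq_bigr => -[J2 [i2 j2]] _; congr (_ * _).
have /matrixP/(_ (mxtens_index (i1, i2)) (mxtens_index (j1, j2))) := st J1 J2.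
by rewrite !tensor_blockE.
Qed.

(** A section of [tensor_block]: the coproduct has to be a list of pairs, so prescribed matrices are
    expanded in pairs of matrix units, with the coefficient carried by the first factor. *)
Definition of_tensor_blocks (D : forall J1 J2, 'M[C]_(m J1 * m J2)) :
    seq (block_alg * block_alg) :=
  [seq (D (tag k) (tag l) (mxtens_index ((tagged k).1, (tagged l).1))
          (mxtens_index ((tagged k).2, (tagged l).2)) *: block_basis k,
        block_basis l) | k <- enum block_index, l <- enum block_index].

Lemma of_tensor_blocksK D J1 J2 : tensor_block J1 J2 (of_tensor_blocks D) = D J1 J2.
Proof.
apply/matrixP => a b.
case: (mxtens_indexP a) => i1 i2; case: (mxtens_indexP b) => j1 j2.
rewrite tensor_blockE big_allpairs_dep /= big_enum /=.
rewrite (bigD1 (Tagged (fun J => ('I_(m J) * 'I_(m J))%type) (i1, j1))) //=.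
rewrite [X in _ + X]big1 ?addr0 => [|k kn]; last first.
  rewrite big1 // => l _; rewrite !ffunE eq_sym (negPf kn).
  by rewrite scaler0 mul0r.
rewrite big_enum /=.
rewrite (bigD1 (Tagged (fun J => ('I_(m J) * 'I_(m J))%type) (i2, j2))) //=.
rewrite [X in _ + X]big1 ?addr0 => [|k kn]; last first.
  rewrite !ffunE (_ : (_ == k) = false) ?mulr0 //.
  by apply/negbTE; rewrite eq_sym.
by rewrite !ffunE !eqxx mulr1 /GRing.scale /= mulr1.
Qed.

Lemma tensor_block_cat J1 J2 s t :
  tensor_block J1 J2 (s ++ t) = tensor_block J1 J2 s + tensor_block J1 J2 t.
Proof. exact: big_cat. Qed.

Lemma tensor_block_scale J1 J2 k s :
  tensor_block J1 J2 [seq (k *: p.1, p.2) | p <- s] = k *: tensor_block J1 J2 s.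
Proof.
rewrite /tensor_block big_map scaler_sumr; apply: eq_bigr => p _.
by apply/matrixP => i j; rewrite /= blockZ !mxE mulrA.
Qed.

Lemma tensor_block_mul J1 J2 s t :
  tensor_block J1 J2 [seq (block_mul p.1 q.1, block_mul p.2 q.2) | p <- s, q <- t]
  = tensor_block J1 J2 s *m tensor_block J1 J2 t.
Proof.
rewrite /tensor_block big_allpairs_dep /= mulmx_suml; apply: eq_bigr => p _.
by rewrite mulmx_sumr; apply: eq_bigr => q _; rewrite !blockM tensmx_mul.
Qed.

Lemma tensor_block_star J1 J2 s :
  tensor_block J1 J2 [seq (block_star p.1, block_star p.2) | p <- s]
  = (tensor_block J1 J2 s)^t*.
Proof.
apply/matrixP => i j; rewrite !mxE /tensor_block !summxE rmorph_sum /= big_map.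
apply: eq_bigr => p _.
by rewrite /= !block_starE !mxE rmorphM.
Qed.

End BlockAlgebra.

(** * The bi-star-algebra given by a blockwise coproduct, and its representations *)

Section BlockBistar.
Variables (C : numClosedFieldType) (I : finType) (m : I -> nat).
Local Notation alg := (block_alg C m).
Variable D : forall J1 J2, alg -> 'M[C]_(m J1 * m J2).
Hypothesis D_linear : forall J1 J2, linear (D J1 J2).
Hypothesis D_mul : forall J1 J2 x y,
  D J1 J2 (block_mul x y) = D J1 J2 x *m D J1 J2 y.
Hypothesis D_star : forall J1 J2 x, D J1 J2 (block_star x) = (D J1 J2 x)^t*.

Definition block_Delta (x : alg) := of_tensor_blocks (fun J1 J2 => D J1 J2 x).

Variable e : alg -> C.
Hypothesis e_linear : scalar e.
Hypothesis e_mul : forall x y, e (block_mul x y) = e x * e y.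
Hypothesis e_star : forall x, e (block_star x) = (e x)^*.
Hypothesis counitl : forall x, \sum_(p <- block_Delta x) e p.1 *: p.2 = x.
Hypothesis counitr : forall x, \sum_(p <- block_Delta x) e p.2 *: p.1 = x.

Variable a : alg.
Hypothesis e_tr : forall x, e (block_tr x) = e x.
Hypothesis a_tr : block_tr a = a.
Hypothesis a_star : block_star a = a.
Hypothesis a_mid : forall x y, block_mul (block_mul x a) y = (e x * e y) *: a.

Lemma block_Delta_linear (k : C) x y : tensor_eq (block_Delta (k *: x + y))
  ([seq (k *: p.1, p.2) | p <- block_Delta x] ++ block_Delta y).
Proof.
apply: tensor_eq_blocks => J1 J2.
by rewrite tensor_block_cat tensor_block_scale !of_tensor_blocksK D_linear.
Qed.

Lemma block_DeltaM x y : tensor_eq (block_Delta (block_mul x y))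
  [seq (block_mul p.1 q.1, block_mul p.2 q.2)
     | p <- block_Delta x, q <- block_Delta y].
Proof.
apply: tensor_eq_blocks => J1 J2.
by rewrite tensor_block_mul !of_tensor_blocksK D_mul.
Qed.

Lemma block_Delta_star x : tensor_eq (block_Delta (block_star x))
  [seq (block_star p.1, block_star p.2) | p <- block_Delta x].
Proof.
apply: tensor_eq_blocks => J1 J2.
by rewrite tensor_block_star !of_tensor_blocksK D_star.
Qed.

(** This is [e] applied to the left counit axiom. By [a_mid], both antipode sums reduce to it. *)
Lemma counit_counit x : \sum_(p <- block_Delta x) e p.1 * e p.2 = e x.
Proof.
pose eL := HB.pack_for {scalar alg} e (GRing.isLinear.Build _ _ _ _ e e_linear).
rewrite -[in RHS](counitl x) -[e]/(eL : alg -> C) linear_sum /=.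
by apply: eq_bigr => p _; rewrite -[e]/(eL : alg -> C) linearZ.
Qed.

Lemma block_S_alpha x :
  \sum_(p <- block_Delta x) block_mul (block_mul (block_tr p.1) a) p.2 = e x *: a.
Proof.
rewrite -counit_counit scaler_suml; apply: eq_bigr => p _.
by rewrite a_mid e_tr.
Qed.

Lemma block_S_beta x :
  \sum_(p <- block_Delta x) block_mul (block_mul p.1 a) (block_tr p.2) = e x *: a.
Proof.
rewrite -counit_counit scaler_suml; apply: eq_bigr => p _.
by rewrite a_mid e_tr.
Qed.

Lemma block_mul_linearl (y : alg) : linear ((@block_mul C I m)^~ y).
Proof.
move=> k x x'; apply: block_inj => J.
by rewrite block_linear !blockM block_linear mulmxDl scalemxAl.
Qed.

Lemma block_mul_linearr (x : alg) : linear (block_mul x).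
Proof.
move=> k y y'; apply: block_inj => J.
by rewrite block_linear !blockM block_linear mulmxDr scalemxAr.
Qed.

Lemma block_mulA : associative (@block_mul C I m).
Proof. by move=> x y z; apply: block_inj => J; rewrite !blockM mulmxA. Qed.

Lemma block_mul1x : left_id (@block_one C I m) (@block_mul C I m).
Proof. by move=> x; apply: block_inj => J; rewrite blockM block1 mul1mx. Qed.

Lemma block_mulx1 : right_id (@block_one C I m) (@block_mul C I m).
Proof. by move=> x; apply: block_inj => J; rewrite blockM block1 mulmx1. Qed.

Lemma block_starK : involutive (@block_star C I m).
Proof. by move=> x; apply: block_inj => J; rewrite !block_starE trmxCK. Qed.

Lemma block_star_antilinear (k : C) (x y : alg) :
  block_star (k *: x + y) = k^* *: block_star x + block_star y.
Proof.
apply: block_inj => J; rewrite block_linear !block_starE block_linear.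
by apply/matrixP => i j; rewrite !mxE rmorphD rmorphM.
Qed.

Lemma block_starM (x y : alg) :
  block_star (block_mul x y) = block_mul (block_star y) (block_star x).
Proof.
apply: block_inj => J.
by rewrite !(blockM, block_starE) trmx_mul map_mxM.
Qed.

Lemma block_tr_linear : linear (@block_tr C I m).
Proof.
move=> k x y; apply: block_inj => J.
by rewrite block_linear !block_trE block_linear linearP.
Qed.

Lemma block_trM (x y : alg) :
  block_tr (block_mul x y) = block_mul (block_tr y) (block_tr x).
Proof. by apply: block_inj => J; rewrite !(blockM, block_trE) trmx_mul. Qed.

Lemma block_trK : involutive (@block_tr C I m).
Proof. by move=> x; apply: block_inj => J; rewrite !block_trE trmxK. Qed.

Lemma block_tr_star (x : alg) :
  block_star (block_tr x) = block_tr (block_star x).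
Proof.
apply: block_inj => J; rewrite !(block_trE, block_starE).
by apply/matrixP => i j; rewrite !mxE.
Qed.

Lemma a_tr_star : a = block_tr (block_star a).
Proof. by rewrite a_star a_tr. Qed.

Definition block_bistar : bistar_algebra C :=
  BistarAlgebra block_mul_linearl block_mul_linearr block_mulA block_mul1x
    block_mulx1 block_starK block_star_antilinear block_starM
    block_Delta_linear block_DeltaM block_Delta_star e_linear e_mul e_star
    counitl counitr block_tr_linear block_trM block_trK block_trK
    block_S_alpha block_S_beta block_tr_star a_tr_star.

Lemma block_boxtimes J1 J2 (x : block_bistar) :
  boxtimes (fun x : block_bistar => block x J1) (fun x => block x J2) x = D J1 J2 x.
Proof. exact: of_tensor_blocksK. Qed.

Hypothesis m_gt0 : forall J, (0 < m J)%N.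

Lemma block_semisimple : semisimple block_bistar.
Proof.
exists #|I|, (fun i => m (enum_val i)), (fun x i => block (x : alg) (enum_val i)).
split=> //.
(* The blocks of [semisimple] are numbered by ['I_#|I|], so the inverse map transports along
   [enum_rankK]. On the way back the transport runs along a loop, trivial by uniqueness of equality
   proofs. *)
- pose g (F : forall i : 'I_#|I|, 'M[C]_(m (enum_val i))) : alg :=
    of_blocks (fun J => eq_rect _ (fun K => 'M[C]_(m K)) (F (enum_rank J)) J
      (enum_rankK J)).
  exists g => [x|F].
    apply: block_inj => J; rewrite of_blocksK.
    by move: (enum_val _) (enum_rankK J) => K p; case: J / p.
  apply: functional_extensionality_dep => i; rewrite of_blocksK.
  move: (enum_rankK (enum_val i)); rewrite enum_valK => p.
  by rewrite (eq_axiomK p).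
- by move=> i; apply: block_linear.
- by move=> i; apply: block1.
- by move=> x y i; apply: blockM.
Qed.

Lemma block_rep J : mx_rep (fun x : block_bistar => block x J).
Proof.
by split; [apply: block_linear | apply: block1 | move=> x y; apply: blockM].
Qed.

Lemma block_unitary J : mx_rep_unitary (fun x : block_bistar => block x J).
Proof. by move=> x; apply: block_starE. Qed.

(* The entries are selected by the numerical values of the indices, which avoids a cast
   of [M] along [K = J]. *)
Definition in_block J (M : 'M[C]_(m J)) : alg :=
  of_blocks (fun K => \matrix_(i, j) if K == J then
     \sum_(i' : 'I_(m J) | i' == i :> nat)
       \sum_(j' : 'I_(m J) | j' == j :> nat) M i' j' else 0).

Lemma in_blockE J M : block (in_block M) J = M.
Proof.
rewrite of_blocksK; apply/matrixP => i j; rewrite !mxE eqxx.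
rewrite (big_pred1 i) => [|i']; last by [].
by rewrite (big_pred1 j) => [|j'].
Qed.

Lemma in_block_neq J K M : K != J -> block (@in_block J M) K = 0.
Proof.
by move=> KJ; rewrite of_blocksK; apply/matrixP => i j; rewrite !mxE (negPf KJ).
Qed.

Lemma in_block0 J : @in_block J 0 = 0.
Proof.
apply: block_inj => K; rewrite block0.
by have [->|KJ] := eqVneq K J; rewrite ?in_blockE ?in_block_neq.
Qed.

Lemma in_blockM J M M' :
  block_mul (@in_block J M) (in_block M') = in_block (M *m M').
Proof.
apply: block_inj => K; rewrite blockM.
have [->|KJ] := eqVneq K J; first by rewrite !in_blockE.
by rewrite !in_block_neq ?mul0mx.
Qed.

Lemma in_block_mull J M x : block_mul x (@in_block J M) = in_block (block x J *m M).
Proof.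
apply: block_inj => K; rewrite blockM.
have [->|KJ] := eqVneq K J; first by rewrite !in_blockE.
by rewrite !in_block_neq ?mulmx0.
Qed.

Lemma in_block_mulr J M x : block_mul (@in_block J M) x = in_block (M *m block x J).
Proof.
apply: block_inj => K; rewrite blockM.
have [->|KJ] := eqVneq K J; first by rewrite !in_blockE.
by rewrite !in_block_neq ?mul0mx.
Qed.

Lemma in_block_sum x : x = \sum_J in_block (block x J).
Proof.
apply: block_inj => K; rewrite block_sum (bigD1 K) //= in_blockE big1 ?addr0 //.
by move=> J JK; rewrite in_block_neq // eq_sym.
Qed.

Lemma in_block_linear J : linear (@in_block J).
Proof.
move=> k M M'; apply: block_inj => K; rewrite block_linear.
have [->|KJ] := eqVneq K J; first by rewrite !in_blockE.
by rewrite !in_block_neq // scaler0 addr0.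
Qed.

(** One nonzero entry [U i j] suffices: the algebra element whose transposed block is [delta_mx j l]
    sends row [i] of [U] to [U i j] times the unit row [l], so [U] contains every unit row. *)
Lemma block_irreducible J : mx_rep_irreducible (fun x : block_bistar => block x J).
Proof.
split=> // U Ustable; have [->|U0] := eqVneq U 0; first by left; rewrite mxrank0.
right; apply/eqP; change (row_full U); rewrite -sub1mx.
have [i [j Uij]] : exists i j, U i j != 0.
  apply: contra_notP (elimN eqP U0) => nU; apply/matrixP => i j; rewrite mxE.
  by apply: contra_notP nU => /eqP Uij; exists i, j.
apply/row_subP => l; rewrite rowE mulmx1 -[X in (X <= _)%MS]scale1r -(mulVf Uij).
rewrite -scalerA scalemx_sub //; apply: submx_trans (Ustable (in_block (delta_mx l j))).
rewrite in_blockE trmx_delta -[X in (_ <= X)%MS]mul1mx.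
have -> : U i j *: delta_mx 0 l = row i U *m delta_mx j l :> 'rV[C]_(m J).
  rewrite [row i U]row_sum_delta mulmx_suml (bigD1 j) //= big1 ?addr0.
    by rewrite -scalemxAl mul_delta_mx mxE.
  by move=> k kj; rewrite -scalemxAl mul_delta_mx_0 ?scaler0.
by rewrite rowE -mulmxA mul1mx submxMl.
Qed.

(** The unit of block [J] acts as 1 in its own representation and as 0 in all others, which kills
    any intertwiner between different blocks. *)
Lemma block_rep_inj J K :
  mx_rep_equiv (fun x : block_bistar => block x J) (fun x => block x K) -> J = K.
Proof.
move=> [X [Y [XY YX XE]]]; apply/eqP; apply: contraT; rewrite eq_sym => KJ.
have := XE (in_block (1%:M : 'M[C]_(m J))).
rewrite in_blockE in_block_neq // mulmx1 mul0mx => X0.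
have := congr1 (fun M : 'M[C]_(m K) => M (Ordinal (m_gt0 K)) (Ordinal (m_gt0 K))) XY.
by rewrite X0 mul0mx !mxE eqxx => /esym/eqP; rewrite oner_eq0.
Qed.

(** Since [sigma] of the unit is nonzero, some diagonal matrix unit [E J i0 i0] acts nontrivially.
    For a nonzero [v] in its range, the vectors [sigma (E J j i0) *m v] are the columns of an
    intertwiner [X] from block [J]; its column space is invariant, hence everything. *)
Lemma block_rep_complete k (sigma : block_bistar -> 'M[C]_k) :
  mx_rep sigma -> mx_rep_irreducible sigma ->
  exists J, mx_rep_equiv sigma (fun x : block_bistar => block x J).
Proof.
move=> [slin s1 sM] [k_gt0 irr].
pose sL := HB.pack_for {linear alg -> 'M[C]_k} sigma
  (GRing.isLinear.Build _ _ _ _ sigma slin).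
have s0 : sigma 0 = 0 by apply: (linear0 sL).
have ssum (T : finType) (F : T -> alg) :
    sigma (\sum_i F i) = \sum_i sigma (F i) by apply: (linear_sum sL).
have sZ c x : sigma (c *: x) = c *: sigma x by apply: (linearZ_LR sL).
have one_neq0 : sigma (bs_one block_bistar) != 0.
  rewrite s1; apply/eqP => /(congr1 (fun M : 'M[C]_k => M (Ordinal k_gt0) (Ordinal k_gt0))).
  by rewrite !mxE eqxx => /eqP; rewrite oner_eq0.
pose E J i j : alg := in_block (delta_mx i j : 'M[C]_(m J)).
have EM J i j l : sigma (E J i j) *m sigma (E J j l) = sigma (E J i l).
  by rewrite -sM /= in_blockM mul_delta_mx.
have inE J (M : 'M[C]_(m J)) : in_block M = \sum_i \sum_j M i j *: E J i j.
  have inlin : linear (@in_block J) by apply: in_block_linear.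
  pose inL := HB.pack_for {linear 'M[C]_(m J) -> alg} (@in_block J)
    (GRing.isLinear.Build _ _ _ _ (@in_block J) inlin).
  rewrite {1}[M]matrix_sum_delta -[@in_block J]/(inL : _ -> _) linear_sum.
  apply: eq_bigr => i _.
  by rewrite linear_sum; apply: eq_bigr => j _; rewrite linearZ_LR.
have [J [i0 sE]] : exists J i, sigma (E J i i) != 0.
  apply: contra_notP (elimN eqP one_neq0) => nE.
  rewrite [bs_one _]in_block_sum ssum big1 // => J _.
  rewrite block1 inE ssum big1 // => i _; rewrite ssum big1 // => j _.
  rewrite sZ -(EM _ _ i) (_ : sigma (E J i i) = 0) ?mul0mx ?scaler0 //.
  by apply: contra_notP nE => /eqP ?; exists J, i.
have [p [q Epq]] : exists p q, sigma (E J i0 i0) p q != 0.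
  apply: contra_notP (elimN eqP sE) => nU; apply/matrixP => p q; rewrite mxE.
  by apply: contra_notP nU => /eqP Uij; exists p, q.
pose v := col q (sigma (E J i0 i0)).
have v0 : v != 0.
  by apply: contraNneq Epq => /(congr1 (fun M : 'cV[C]_k => M p 0)); rewrite !mxE => ->.
pose X : 'M[C]_(k, m J) := \matrix_(i, j) (sigma (E J j i0) *m v) i 0.
have colX j : col j X = sigma (E J j i0) *m v.
  by apply/colP => i; rewrite !mxE.
have Ev j : sigma (E J i0 j) *m (sigma (E J j i0) *m v) = v.
  by rewrite /v colE !mulmxA !EM.
have XE x : sigma x *m X = X *m block x J.
  apply/matrixP => i j.
  transitivity ((sigma x *m X *m delta_mx j (0 : 'I_1)) i 0).
    by rewrite -colE [RHS]mxE.
  rewrite -mulmxA -colE colX mulmxA -sM /= in_block_mull.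
  have -> : in_block (block x J *m delta_mx j i0) = \sum_l block x J l j *: E J l i0.
    rewrite inE; apply: eq_bigr => l _; rewrite (bigD1 i0) //= big1 ?addr0.
      congr (_ *: _); rewrite mxE (bigD1 j) //= [delta_mx _ _ _ _]mxE !eqxx mulr1 big1 ?addr0 //.
      by move=> l' l'j; rewrite [delta_mx _ _ _ _]mxE (negPf l'j) mulr0.
    move=> l' l'0; rewrite mxE big1 ?scale0r // => j' _.
    by rewrite [delta_mx _ _ _ _]mxE (negPf l'0) andbF mulr0.
  rewrite ssum mulmx_suml summxE mxE; apply: eq_bigr => l _.
  by rewrite sZ -scalemxAl -colX !mxE mulrC.
(* A functional with value 1 at [v]. The rows [u *m sigma (E J i0 i)] then form a left inverse of
   [X]. *)
pose u : 'rV[C]_k := (v p 0)^-1 *: delta_mx 0 p.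
have vp0 : v p 0 != 0 by rewrite mxE.
have uv : u *m v = 1%:M.
  rewrite -scalemxAl -rowE; apply/matrixP => i j.
  by rewrite !ord1 [LHS]mxE [X in _ * X]mxE mulVf // [RHS]mxE.
pose Y : 'M[C]_(m J, k) := \matrix_(i, j) (u *m sigma (E J i0 i)) 0 j.
have rowY j : row j Y = u *m sigma (E J i0 j) by apply/rowP => i; rewrite !mxE.
have YX : Y *m X = 1%:M.
  apply/matrixP => i j; have -> : (Y *m X) i j = (row i Y *m col j X) 0 0.
    by rewrite !mxE; apply: eq_bigr => l _; rewrite !mxE.
  rewrite rowY colX -mulmxA [RHS]mxE; have [<-|ij] := eqVneq i j.
    by rewrite Ev uv mxE eqxx.
  rewrite (mulmxA (sigma _)) -sM /= in_blockM mul_delta_mx_0 // in_block0.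
  by rewrite -[0 : block_bistar]/(0 : alg) s0 mul0mx mulmx0 mxE.
have rX : \rank <<X^T>>%MS = k.
  have [x||//] := irr <<X^T>>%MS.
    rewrite (eqmxMr _ (genmxE _)) genmxE -trmx_mul XE trmx_mul.
    exact: submxMl.
  rewrite genmxE mxrank_tr => /eqP; rewrite mxrank_eq0 => /eqP X0.
  have := congr1 (fun M : 'M[C]_(m J) => M i0 i0) YX.
  by rewrite X0 mulmx0 !mxE eqxx => /esym/eqP; rewrite oner_eq0.
have /row_freeP[Z XZ] : row_free X by rewrite /row_free -[X in _ == X]rX genmxE mxrank_tr.
have YZ : Y = Z by rewrite -[Y]mulmx1 -XZ mulmxA YX mul1mx.
have XY : X *m Y = 1%:M by rewrite YZ.
exists J, Y, X; split=> // x.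
by rewrite -[RHS]mul1mx -YX -!mulmxA (mulmxA X) -XE -!mulmxA XY mulmx1.
Qed.

End BlockBistar.

(** * The algebra with prescribed multiplicities *)

Section FusionAlgebra.
Variables (C : numClosedFieldType) (I : finType) (o : I) (N : I -> I -> I -> nat).
Hypothesis N_unitl : forall J K, N o J K = (J == K).
Hypothesis N_unitr : forall J K, N J o K = (J == K).

(* The sectors other than the vacuum share one size, large enough that
   [\sum_K N J1 J2 K * m K <= m J1 * m J2]. *)
Definition block_size J : nat :=
  if J == o then 1 else (\sum_J1 \sum_J2 \sum_K N J1 J2 K).+1.
Local Notation m := block_size.

Lemma block_size_gt0 J : (0 < m J)%N. Proof. by rewrite /m; case: ifP. Qed.

Lemma block_size_vacuum : m o = 1%N. Proof. by rewrite /m eqxx. Qed.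

Definition vac : 'I_(m o) := Ordinal (block_size_gt0 o).

Lemma vac_uniq (i : 'I_(m o)) : i = vac.
Proof.
by apply: val_inj; case: i => i /= lti; move: (lti); rewrite block_size_vacuum; case: i lti.
Qed.

(** No block is larger than [B], so the left side is at most [(\sum_K N J1 J2 K) * B], and [B]
    exceeds the sum of all multiplicities. *)
Lemma fusion_card J1 J2 : J1 != o -> J2 != o ->
  (#|{: {K : I & ('I_(N J1 J2 K) * 'I_(m K))%type}}| <= m J1 * m J2)%N.
Proof.
move=> J1o J2o; rewrite card_tagged sumnE big_map big_enum /=.
set B := (\sum_J1 \sum_J2 \sum_K N J1 J2 K).+1.
have mB K : (m K <= B)%N by rewrite /m; case: ifP.
have mE J : J != o -> m J = B by rewrite /m => /negPf ->.
rewrite (mE J1) // (mE J2) //.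
apply: (@leq_trans (\sum_K N J1 J2 K * B)%N).
  by apply: leq_sum => K _; rewrite card_prod !card_ord leq_mul2l mB orbT.
rewrite -big_distrl /= leq_mul2r; apply/orP; right; apply: leqW.
apply: (@leq_trans (\sum_J \sum_K N J1 J K)%N).
  by rewrite [leqRHS](bigD1 J2) //= leq_addr.
by rewrite [leqRHS](bigD1 J1) //= leq_addr.
Qed.

(** The copies of the blocks [K] are placed on disjoint sets of coordinates of the tensor product.
    If a factor is the vacuum, the placement has to preserve coordinates, because the counit axioms
    hold on the nose. Comparing numerical values avoids casts between ordinal types. *)
Lemma fusion_injection J1 J2 :
  exists f : forall K, 'I_(N J1 J2 K) -> 'I_(m K) -> 'I_(m J1 * m J2),
    (forall K K' n n' i i', f K n i = f K' n' i' ->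
       [&& K == K', n == n' :> nat & i == i' :> nat]) /\
    ((J1 == o) || (J2 == o) -> forall K n i, f K n i = i :> nat).
Proof.
have [J12|J12] := boolP ((J1 == o) || (J2 == o)); last first.
  have [J1o J2o] := norP J12.
  exists (fun K n i => widen_ord (fusion_card J1o J2o) (enum_rank
    (Tagged (fun K => ('I_(N J1 J2 K) * 'I_(m K))%type) (n, i)))).
  split=> // K K' n n' i i' /(congr1 val)/= /val_inj/enum_rank_inj/eqP.
  by rewrite -tag_eqE => /andP[/= /eqP KK]; subst K'; rewrite tagged_asE eqxx.
have NJ K : N J1 J2 K = (K == (if J1 == o then J2 else J1)).
  by case: eqP J12 => [-> _|_ /= /eqP ->]; rewrite ?N_unitl ?N_unitr eq_sym.
have mJ : (m J1 * m J2 = m (if J1 == o then J2 else J1))%N.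
  by case: eqP J12 => [-> _|_ /= /eqP ->]; rewrite block_size_vacuum ?mul1n ?muln1.
(* An index [n] exists only if [K] is the non-vacuum side of the product (either side if both are
   the vacuum), and then [m K] is [m J1 * m J2]. *)
have lt K (n : 'I_(N J1 J2 K)) (i : 'I_(m K)) : (i < m J1 * m J2)%N.
  by move: n; rewrite NJ mJ; case: eqP => [<- _|_ []].
exists (fun K n i => Ordinal (lt K n i)); split=> // K K' n n' i i' /(congr1 val)/= ->.
rewrite eqxx andbT; move: n n'; rewrite !NJ => n n'; move: n n'.
by case: eqP => [->|_ []//] ?; case: eqP => [->|_ []//] ?; rewrite eqxx !ord1.
Qed.

(** Column [i] of [W] is the unit vector at [f K n i], so the orthogonality relations express the
    injectivity of [f]. *)
Lemma fusion_isometries : exists W : forall J1 J2 K,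
    'I_(N J1 J2 K) -> 'M[C]_(m J1 * m J2, m K),
  [/\ forall J1 J2 K K' n n', (W J1 J2 K n)^t* *m W J1 J2 K' n' =
        \matrix_(i, j) [&& K == K', n == n' :> nat & i == j :> nat]%:R,
      forall J K n a i' i, W o J K n (mxtens_index (a, i')) i = (i' == i :> nat)%:R &
      forall J K n a i' i, W J o K n (mxtens_index (i', a)) i = (i' == i :> nat)%:R].
Proof.
pose f J1 J2 := sval (cid (fusion_injection J1 J2)).
have f_inj J1 J2 := (svalP (cid (fusion_injection J1 J2))).1.
have f_unit J1 J2 := (svalP (cid (fusion_injection J1 J2))).2.
exists (fun J1 J2 K n => \matrix_(a, i) (a == f J1 J2 K n i)%:R); split.
- move=> J1 J2 K K' n n'; apply/matrixP => i j; rewrite !mxE.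
  rewrite (bigD1 (f J1 J2 K n i)) //= !mxE eqxx rmorph1 mul1r big1 ?addr0.
    congr ((nat_of_bool _)%:R); apply/eqP/idP => [/f_inj//|/and3P[/eqP KK /eqP nn /eqP ij]].
    by subst K'; congr (f _ _ _ _ _); apply: val_inj.
  by move=> k /negPf kf; rewrite !mxE kf rmorph0 mul0r.
- move=> J K n a i' i; rewrite mxE; congr (nat_of_bool _)%:R.
  rewrite -val_eqE /= (vac_uniq a) f_unit ?eqxx //.
- move=> J K n a i' i; rewrite mxE; congr (nat_of_bool _)%:R.
  rewrite -val_eqE /= (vac_uniq a) f_unit ?eqxx ?orbT // addn0.
  by rewrite block_size_vacuum muln1.
Qed.

Section FusionCoproduct.
Variable W : forall J1 J2 K, 'I_(N J1 J2 K) -> 'M[C]_(m J1 * m J2, m K).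
Hypothesis W_ortho : forall J1 J2 K K' n n', (W n)^t* *m @W J1 J2 K' n' =
  \matrix_(i < m K, j < m K') [&& K == K', n == n' :> nat & i == j :> nat]%:R.
Hypothesis W_vacl : forall J K (n : 'I_(N o J K)) a i' i,
  W n (mxtens_index (a, i')) i = (i' == i :> nat)%:R.
Hypothesis W_vacr : forall J K (n : 'I_(N J o K)) a i' i,
  W n (mxtens_index (i', a)) i = (i' == i :> nat)%:R.
Local Notation alg := (block_alg C m).

Definition fusion_coproduct J1 J2 (x : alg) : 'M[C]_(m J1 * m J2) :=
  \sum_K \sum_(n < N J1 J2 K) W n *m block x K *m (W n)^t*.
Local Notation D := fusion_coproduct.

Lemma W_ortho_eq J1 J2 K (n n' : 'I_(N J1 J2 K)) :
  (W n)^t* *m W n' = if n == n' then 1%:M else 0.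
Proof.
rewrite W_ortho; apply/matrixP => i j; rewrite !mxE eqxx /= !val_eqE.
by case: (n == n'); rewrite !mxE.
Qed.

Lemma W_ortho_neq J1 J2 K K' (n : 'I_(N J1 J2 K)) (n' : 'I_(N J1 J2 K')) :
  K != K' -> (W n)^t* *m W n' = 0.
Proof. by rewrite W_ortho => /negPf ->; apply/matrixP => i j; rewrite !mxE. Qed.

Lemma fusion_coproduct_linear J1 J2 : linear (@D J1 J2).
Proof.
move=> k x y; rewrite /D scaler_sumr -big_split; apply: eq_bigr => K _.
rewrite scaler_sumr -big_split; apply: eq_bigr => n _.
by rewrite block_linear mulmxDr mulmxDl -scalemxAr -scalemxAl.
Qed.

(** Each [W n] embeds block [K] into the product. Multiplicativity of the coproduct and the count of
    Clebsch-Gordan maps both rest on this relation. *)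
Lemma fusion_coproduct_isometry J1 J2 x K (n : 'I_(N J1 J2 K)) :
  D J1 J2 x *m W n = W n *m block x K.
Proof.
rewrite mulmx_suml (bigD1 K) //= [X in _ + X]big1 ?addr0; last first.
  move=> K' KK; rewrite mulmx_suml big1 // => n' _.
  by rewrite -mulmxA W_ortho_neq ?mulmx0.
rewrite mulmx_suml (bigD1 n) //= [X in _ + X]big1 ?addr0; last first.
  by move=> n' /negPf nn; rewrite -mulmxA W_ortho_eq nn mulmx0.
by rewrite -mulmxA W_ortho_eq eqxx mulmx1.
Qed.

Lemma fusion_coproduct_mul J1 J2 x y :
  D J1 J2 (block_mul x y) = D J1 J2 x *m D J1 J2 y.
Proof.
rewrite [in RHS]/(D J1 J2 y) mulmx_sumr; apply: eq_bigr => K _.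
rewrite mulmx_sumr; apply: eq_bigr => n _.
by rewrite !mulmxA fusion_coproduct_isometry blockM mulmxA.
Qed.

Lemma fusion_coproduct_star J1 J2 x : D J1 J2 (block_star x) = (D J1 J2 x)^t*.
Proof.
rewrite /D !raddf_sum /=; apply: eq_bigr => K _.
rewrite !raddf_sum /=; apply: eq_bigr => n _.
by rewrite block_starE !trmx_mul !map_mxM !mulmxA trmxCK.
Qed.

(** The left counit axiom in matrix form. As [N o J K] is 1 for [K = J] and 0 otherwise, a single
    term survives, and its [W] is an identity matrix. *)
Lemma fusion_coproduct_vacl J a b x (i j : 'I_(m J)) :
  D o J x (mxtens_index (a, i)) (mxtens_index (b, j)) = block x J i j.
Proof.
rewrite /D summxE (bigD1 J) //= [X in _ + X]big1 ?addr0; last first.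
  move=> K; rewrite eq_sym => /negPf JK; rewrite big1 ?mxE // => n.
  by exfalso; move: n; rewrite N_unitl JK => -[].
have n0 : 'I_(N o J J) by rewrite N_unitl eqxx; apply: ord0.
rewrite (big_pred1 n0) => [|n]; last first.
  by apply/esym/eqP/val_inj; move: n n0; rewrite N_unitl eqxx => n n0; rewrite !ord1.
rewrite mxE (bigD1 j) //= !mxE W_vacl eqxx rmorph1 mulr1.
rewrite [X in _ + X]big1 ?addr0; last first.
  by move=> k /negPf kj; rewrite !mxE W_vacl eq_sym val_eqE kj rmorph0 mulr0.
rewrite (bigD1 i) //= W_vacl eqxx mul1r big1 ?addr0 ?mxE // => k /negPf ki.
by rewrite W_vacl eq_sym val_eqE ki mul0r.
Qed.

Lemma fusion_coproduct_vacr J a b x (i j : 'I_(m J)) :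
  D J o x (mxtens_index (i, a)) (mxtens_index (j, b)) = block x J i j.
Proof.
rewrite /D summxE (bigD1 J) //= [X in _ + X]big1 ?addr0; last first.
  move=> K; rewrite eq_sym => /negPf JK; rewrite big1 ?mxE // => n.
  by exfalso; move: n; rewrite N_unitr JK => -[].
have n0 : 'I_(N J o J) by rewrite N_unitr eqxx; apply: ord0.
rewrite (big_pred1 n0) => [|n]; last first.
  by apply/esym/eqP/val_inj; move: n n0; rewrite N_unitr eqxx => n n0; rewrite !ord1.
rewrite mxE (bigD1 j) //= !mxE W_vacr eqxx rmorph1 mulr1.
rewrite [X in _ + X]big1 ?addr0; last first.
  by move=> k /negPf kj; rewrite !mxE W_vacr eq_sym val_eqE kj rmorph0 mulr0.
rewrite (bigD1 i) //= W_vacr eqxx mul1r big1 ?addr0 ?mxE // => k /negPf ki.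
by rewrite W_vacr eq_sym val_eqE ki mul0r.
Qed.

Definition vac_counit (x : alg) : C := block x o vac vac.

Lemma vac_counit_linear : scalar vac_counit.
Proof. by move=> k x y; rewrite /vac_counit block_linear !mxE. Qed.

Lemma vac_counitM x y :
  vac_counit (block_mul x y) = vac_counit x * vac_counit y.
Proof.
rewrite /vac_counit blockM mxE (big_pred1 vac) // => k.
exact/esym/eqP/vac_uniq.
Qed.

Lemma vac_counit_star x : vac_counit (block_star x) = (vac_counit x)^*.
Proof. by rewrite /vac_counit block_starE !mxE. Qed.

Lemma vac_counit_tr x : vac_counit (block_tr x) = vac_counit x.
Proof. by rewrite /vac_counit block_trE !mxE. Qed.

Lemma vac_counitl x : \sum_(p <- block_Delta D x) vac_counit p.1 *: p.2 = x.
Proof.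
apply: block_inj => J; rewrite block_sum; apply/matrixP => i j.
rewrite -[RHS](fusion_coproduct_vacl vac vac) -[D o J x](of_tensor_blocksK (fun J1 J2 => D J1 J2 x)).
rewrite tensor_blockE summxE; apply: eq_bigr => p _.
by rewrite blockZ /vac_counit !mxE.
Qed.

Lemma vac_counitr x : \sum_(p <- block_Delta D x) vac_counit p.2 *: p.1 = x.
Proof.
apply: block_inj => J; rewrite block_sum; apply/matrixP => i j.
rewrite -[RHS](fusion_coproduct_vacr vac vac) -[D J o x](of_tensor_blocksK (fun J1 J2 => D J1 J2 x)).
rewrite tensor_blockE summxE; apply: eq_bigr => p _.
by rewrite blockZ /vac_counit !mxE mulrC.
Qed.

(* This element is both [alpha] and [beta]. Only the (vacuum, vacuum) component of the
   coproduct then enters the antipode axioms, so that the antipode can be the blockwise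
   transposition and no conjugate sectors are needed. *)
Definition vac_unit : alg := in_block (1%:M : 'M[C]_(m o)).

Lemma vac_unit_tr : block_tr vac_unit = vac_unit.
Proof.
apply: block_inj => J; rewrite block_trE.
have [->|Jo] := eqVneq J o; first by rewrite in_blockE trmx1.
by rewrite in_block_neq // trmx0.
Qed.

Lemma vac_unit_star : block_star vac_unit = vac_unit.
Proof.
apply: block_inj => J; rewrite block_starE.
have [->|Jo] := eqVneq J o; first by rewrite in_blockE trmx1 map_mx1.
by rewrite in_block_neq // trmx0 map_mx0.
Qed.

Lemma vac_unit_mid x y : block_mul (block_mul x vac_unit) y =
  (vac_counit x * vac_counit y) *: vac_unit.
Proof.
rewrite in_block_mull mulmx1 in_block_mulr; apply: block_inj => J; rewrite blockZ.
have [->|Jo] := eqVneq J o; last by rewrite !in_block_neq ?scaler0.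
rewrite !in_blockE -vac_counitM; apply/matrixP => i j.
rewrite (vac_uniq i) (vac_uniq j) -blockM.
by rewrite [RHS]mxE [X in _ * X]mxE eqxx mulr1.
Qed.

Definition fusion_bistar : bistar_algebra C :=
  block_bistar fusion_coproduct_linear fusion_coproduct_mul
    fusion_coproduct_star vac_counit_linear vac_counitM vac_counit_star
    vac_counitl vac_counitr vac_counit_tr vac_unit_tr vac_unit_star vac_unit_mid.

(** An intertwiner [X] is known from the products [X *m W n]. They vanish for blocks other than [K],
    as the unit of that block shows, and for block [K] they commute with all matrices, so they are
    scalars: the coordinates of [X]. *)
Lemma fusion_clebsch_gordan J1 J2 K :
  has_dim (clebsch_gordan (fun x : fusion_bistar => block x J1)
    (fun x => block x J2) (fun x => block x K)) (N J1 J2 K).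
Proof.
exists (fun n => (@W J1 J2 K n)^t*) => [n x|X XE].
  rewrite block_boxtimes; apply: (can_inj (@trmxCK _ _ _)).
  rewrite !trmx_mul !map_mxM !trmxCK -fusion_coproduct_star -block_starE.
  by rewrite fusion_coproduct_isometry.
have {}XE x : X *m D J1 J2 x = block x K *m X.
  by have := XE x; rewrite block_boxtimes.
have XW x K' (n : 'I_(N J1 J2 K')) : X *m W n *m block x K' = block x K *m (X *m W n).
  by rewrite -mulmxA -fusion_coproduct_isometry mulmxA XE mulmxA.
have XW0 K' (n : 'I_(N J1 J2 K')) : K' != K -> X *m W n = 0.
  move=> KK; have := XW (in_block (1%:M : 'M[C]_(m K'))) K' n.
  by rewrite in_blockE in_block_neq ?mul0mx ?mulmx1 // eq_sym.
have XWK (n : 'I_(N J1 J2 K)) : exists c : C, X *m W n = c%:M.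
  apply: (@mx_commutant_scalar _ _ (Ordinal (block_size_gt0 K))) => M.
  by have := XW (in_block M) K n; rewrite !in_blockE.
pose k0 := Ordinal (block_size_gt0 K).
pose c : {ffun 'I_(N J1 J2 K) -> C} := [ffun n => (X *m W n) k0 k0].
have cE n : X *m W n = (c n)%:M.
  by rewrite ffunE; have [d ->] := XWK n; rewrite !mxE eqxx.
exists c; split.
  (* The coproduct of the unit is only the projection onto the span of the ranges of the [W n], but
     [X] absorbs it since the unit has block 1 at [K]. Hence [X] has no component off these
     ranges. *)
  have := XE (block_one C m); rewrite block1 mul1mx => <-.
  rewrite mulmx_sumr (bigD1 K) //= [X in _ + X]big1 ?addr0; last first.
    move=> K' KK; rewrite mulmx_sumr big1 // => n _.
    by rewrite !mulmxA XW0 // !mul0mx.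
  rewrite mulmx_sumr; apply: eq_bigr => n _.
  by rewrite block1 mulmx1 mulmxA cE mul_scalar_mx.
move=> c' XE'; apply/ffunP => n; rewrite ffunE {1}XE' mulmx_suml summxE.
rewrite (bigD1 n) //= -scalemxAl W_ortho_eq eqxx !mxE eqxx mulr1 big1 ?addr0 //.
by move=> n' /negPf nn; rewrite -scalemxAl W_ortho_eq nn scaler0 mxE.
Qed.

End FusionCoproduct.

Theorem exists_fusion_bistar : exists G : bistar_algebra C, semisimple G /\
  exists (d : I -> nat) (tau : forall J : I, G -> 'M[C]_(d J)),
    [/\ forall J, [/\ mx_rep (tau J), mx_rep_irreducible (tau J) &
                      mx_rep_unitary (tau J)],
        forall J K, mx_rep_equiv (tau J) (tau K) -> J = K,
        forall k (sigma : G -> 'M[C]_k),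
          mx_rep sigma -> mx_rep_irreducible sigma ->
          exists J, mx_rep_equiv sigma (tau J) &
        forall J1 J2 K,
          has_dim (clebsch_gordan (tau J1) (tau J2) (tau K)) (N J1 J2 K)].
Proof.
have [W [W1 W2 W3]] := fusion_isometries.
exists (fusion_bistar W1 W2 W3); split.
  exact/block_semisimple/block_size_gt0.
exists m, (fun J x => block x J); split.
- move=> J; split; first exact: block_rep.
    exact/block_irreducible/block_size_gt0.
  exact: block_unitary.
- by move=> J K; apply/block_rep_inj/block_size_gt0.
- by move=> k sigma; apply: block_rep_complete.
- by move=> J1 J2 K; apply: fusion_clebsch_gordan.
Qed.

End FusionAlgebra.

(** Over an empty index type the block algebra has a single element, so equations between its
    elements are automatic. The only linear form is 0, which therefore is the counit; the size 1 is
    a placeholder. *)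
Theorem exists_empty_bistar (C : numClosedFieldType) (I : finType) (I0 : I -> False) :
  exists G : bistar_algebra C, semisimple G /\
    forall k (sigma : G -> 'M[C]_k), mx_rep sigma -> mx_rep_irreducible sigma -> False.
Proof.
pose alg := block_alg C (fun _ : I => 1%N).
have eqA (x y : alg) : x = y by apply: block_inj => J; case: (I0 J).
pose D (J1 J2 : I) (x : alg) : 'M[C]_(1 * 1) := 0.
pose e (x : alg) : C := 0.
have Dl J1 J2 : linear (D J1 J2) by case: (I0 J1).
have Dm J1 J2 x y : D J1 J2 (block_mul x y) = D J1 J2 x *m D J1 J2 y.
  by case: (I0 J1).
have Ds J1 J2 x : D J1 J2 (block_star x) = map_mx Num.conj (D J1 J2 x)^T.
  by case: (I0 J1).
have el : scalar e by move=> k x y; rewrite /e mulr0 addr0.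
have em x y : e (block_mul x y) = e x * e y by rewrite /e mulr0.
have es x : e (block_star x) = (e x)^* by rewrite /e rmorph0.
have cl x : \sum_(p <- block_Delta D x) e p.1 *: p.2 = x by apply: eqA.
have cr x : \sum_(p <- block_Delta D x) e p.2 *: p.1 = x by apply: eqA.
have et x : e (block_tr x) = e x by [].
have mid x y : block_mul (block_mul x 0) y = (e x * e y) *: (0 : alg) by apply: eqA.
exists (block_bistar Dl Dm Ds el em es cl cr et (eqA _ 0) (eqA _ 0) mid).
split=> [|k sigma sr si]; first by apply: block_semisimple => J.
by have [J _] := block_rep_complete sr si; apply: I0 J.
Qed.

(** * Bounded operators and Schur's lemma *)

Section HilbertOperators.
Variables (R : realType) (H : hilbert R).
Local Notation C := R[i].
Implicit Types (x y z : H) (a b c t : H -> H) (k e : C).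

Lemma hdotDl x y z : hdot (x + y) z = hdot x z + hdot y z.
Proof. exact: linearDl. Qed.
Lemma hdotDr x y z : hdot x (y + z) = hdot x y + hdot x z.
Proof. exact: linearDr. Qed.
Lemma hdotZl k x y : hdot (k *: x) y = k * hdot x y.
Proof. exact: linearZl_LR. Qed.
Lemma hdotZr k x y : hdot x (k *: y) = k^* * hdot x y.
Proof. exact: linearZr_LR. Qed.
Lemma hdot0l x : hdot 0 x = 0.
Proof. exact: linear0l. Qed.
Lemma hdot0r x : hdot x 0 = 0.
Proof. exact: linear0r. Qed.
Lemma hdotNl x y : hdot (- x) y = - hdot x y.
Proof. exact: linearNl. Qed.
Lemma hdotBl x y z : hdot (x - y) z = hdot x z - hdot y z.
Proof. exact: linearBl. Qed.
Lemma hdotBr x y z : hdot x (y - z) = hdot x y - hdot x z.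
Proof. exact: linearBr. Qed.
Lemma hdotC x y : hdot x y = (hdot y x)^*.
Proof. by rewrite hermC expr0 mul1r. Qed.
Lemma hdot_ge0 x : 0 <= hdot x x.
Proof. by rewrite -hdotE exprn_ge0. Qed.

Lemma hdot_ext x y : (forall z, hdot x z = hdot y z) -> x = y.
Proof.
move=> xy; apply/eqP; rewrite -subr_eq0 -normr_eq0 -sqrf_eq0 hdotE.
by rewrite hdotBl xy subrr.
Qed.

(* Positivity forces [r = q^*], so no Hermitian symmetry has to be assumed. *)
Lemma sesqui_discriminant (p q r s : C) :
  (forall z : C, 0 <= p + z * q + z^* * r + (z * z^*) * s) ->
  `|q| ^+ 2 <= p * s.
Proof.
case: p q r s => [p1 p2] [q1 q2] [r1 r2] [s1 s2] h.
have {}h u v : p2 + u * (q2 + r2) + v * (q1 - r1) + (u ^+ 2 + v ^+ 2) * s2 = 0 /\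
    0 <= p1 + u * (q1 + r1) + v * (r2 - q2) + (u ^+ 2 + v ^+ 2) * s1.
  have := h (Complex u v); rewrite lecE /= => /andP[/eqP i_eq r_ge]; split.
    by rewrite -i_eq; ring.
  by move: r_ge; congr (_ <= _); ring.
(* The points [0], [1], [-1], [i] and [-i] suffice to see that [p] and [s] are real and that [r] is
   the conjugate of [q]. *)
have [i0 r0] := h 0 0; have [i1 _] := h 1 0; have [i2 _] := h (- 1) 0.
have [i3 _] := h 0 1; have [i4 _] := h 0 (- 1).
have p20 : p2 = 0 by lra.
have s20 : s2 = 0 by lra.
have qr2 : r2 = - q2 by lra.
have qr1 : r1 = q1 by lra.
(* Taking [z] to be [- t] times the conjugate of [q] leaves a real quadratic in [t]. For [s1 > 0]
   its minimum is at [t = s1^-1]. *)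
have h0 := h; have {}h (t : R) : 0 <= p1 - 2 * t * (q1 ^+ 2 + q2 ^+ 2) + t ^+ 2 * (q1 ^+ 2 + q2 ^+ 2) * s1.
  have [_] := h (- t * q1) (t * q2); rewrite qr1 qr2; congr (_ <= _); ring.
rewrite normCK p20 s20 lecE /=; apply/andP; split; first by apply/eqP; ring.
have -> : q1 * q1 - q2 * - q2 = q1 ^+ 2 + q2 ^+ 2 by ring.
have -> : p1 * s1 - 0 * 0 = p1 * s1 by ring.
have p10 : 0 <= p1 by lra.
set Q := q1 ^+ 2 + q2 ^+ 2 in h *.
have Q0 : 0 <= Q by rewrite addr_ge0 ?sqr_ge0.
have [s10|s10] := ltP 0 s1.
  have := h s1^-1; have -> : s1^-1 ^+ 2 * Q * s1 = s1^-1 * Q by field; lra.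
  move=> h1; rewrite -ler_pdivrMr //; lra.
have Q_eq0 : Q = 0.
  apply/eqP; rewrite -[_ == _]negbK; apply/negP => Qn0.
  have Qgt0 : 0 < Q by rewrite lt_def Qn0.
  have := h ((p1 + 1) / Q).
  have -> : 2 * ((p1 + 1) / Q) * Q = 2 * (p1 + 1) by field.
  have : 0 <= ((p1 + 1) / Q) ^+ 2 * Q by rewrite mulr_ge0 ?sqr_ge0.
  by set w := (_ ^+ 2 * Q); nra.
suff -> : s1 = 0 by rewrite Q_eq0 mulr0.
apply/eqP; apply: contraT => s1n; have s1_lt0 : s1 < 0 by rewrite lt_def eq_sym s1n.
(* Adding the inequalities at [z = w + 1] and [z = - (w + 1)] cancels the linear terms, and
   [(w + 1) ^+ 2 * - s1] is at least [w * - s1 = p1 + 1], too large for [p1] to compensate. *)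
pose w := (p1 + 1) / - s1; have wE : w * - s1 = p1 + 1 by rewrite /w; field.
have w_ge0 : 0 <= w by rewrite divr_ge0; lra.
have [_] := h0 (w + 1) 0; have [_] := h0 (- (w + 1)) 0; nra.
Qed.

Lemma CauchySchwarz_hdot x y : `|hdot x y| <= `|x| * `|y|.
Proof.
rewrite -(@ler_pXn2r _ 2) ?nnegrE ?mulr_ge0 // exprMn !hdotE.
apply: (@sesqui_discriminant _ _ (hdot y x)) => z.
have := hdot_ge0 (x + z^* *: y).
rewrite !(hdotDl, hdotDr, hdotZl, hdotZr) conjCK.
by congr (_ <= _); ring.
Qed.

Lemma linear_op0 a : linear a -> a 0 = 0.
Proof. by move=> la; have := la (- 1) 0 0; rewrite scaler0 addr0 scaleN1r addNr. Qed.
Lemma linear_opD a x y : linear a -> a (x + y) = a x + a y.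
Proof. by move=> la; have := la 1 x y; rewrite !scale1r. Qed.
Lemma linear_opZ a k x : linear a -> a (k *: x) = k *: a x.
Proof. by move=> la; have := la k x 0; rewrite (linear_op0 la) !addr0. Qed.
Lemma linear_opB a x y : linear a -> a (x - y) = a x - a y.
Proof.
move=> la; rewrite (linear_opD _ _ la) -[- y]scaleN1r (linear_opZ _ _ la).
by rewrite scaleN1r. Qed.

Definition op_bound a k := 0 <= k /\ forall x, `|a x| <= k * `|x|.

Lemma bounded_opP a : bounded_op a <-> linear a /\ exists k, op_bound a k.
Proof.
split=> [[la ca]|[la [k [k0 ak]]]]; split=> //.
  pose aL := HB.pack_for {linear H -> H} a (GRing.isLinear.Build _ _ _ _ a la).
  have /linear_boundedP : bounded_near aL (nbhs (0 : H)).
    by apply/linear_bounded_continuous.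
  by move=> /pinfty_ex_gt0[k k0 ak]; exists k; split=> //; apply: ltW.
pose aL := HB.pack_for {linear H -> H} a (GRing.isLinear.Build _ _ _ _ a la).
apply: (bounded_linear_continuous (f := aL)); apply/linear_boundedP.
exists k; split=> [|r kr x]; first exact: ger0_real.
by apply: le_trans (ak x) _; rewrite ler_wpM2r // ltW.
Qed.

Lemma bounded_op_linear a : bounded_op a -> linear a.
Proof. by case. Qed.

Lemma bounded_op_id : bounded_op (idfun : H -> H).
Proof.
by apply/bounded_opP; split=> //; exists 1; split=> // x; rewrite mul1r.
Qed.

Lemma op_bound_comp a b k l : op_bound a k -> op_bound b l -> op_bound (a \o b) (k * l).
Proof.
move=> [k0 ak] [l0 bl]; split=> [|x]; first exact: mulr_ge0.
by apply: le_trans (ak _) _; rewrite -mulrA ler_wpM2l.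
Qed.

Lemma op_boundD a b k l : op_bound a k -> op_bound b l -> op_bound (a + b) (k + l).
Proof.
move=> [k0 ak] [l0 bl]; split=> [|x]; first exact: addr_ge0.
by apply: le_trans (ler_normD _ _) _; rewrite mulrDl lerD.
Qed.

Lemma op_boundZ a k l : op_bound a k -> op_bound (l *: a) (`|l| * k).
Proof.
move=> [k0 ak]; split=> [|x]; first exact: mulr_ge0.
by rewrite normrZ -mulrA ler_wpM2l.
Qed.

Lemma bounded_op_comp a b : bounded_op a -> bounded_op b -> bounded_op (a \o b).
Proof.
move=> /bounded_opP[la [k ak]] /bounded_opP[lb [l bl]]; apply/bounded_opP; split.
  by move=> r x y /=; rewrite lb la.
by exists (k * l); apply: op_bound_comp.
Qed.

Lemma bounded_op_lin k a b : bounded_op a -> bounded_op b -> bounded_op (k *: a + b).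
Proof.
move=> /bounded_opP[la [r ar]] /bounded_opP[lb [l bl]]; apply/bounded_opP; split.
  move=> s x y; rewrite -[LHS]/(k *: a _ + b _) la lb.
  by rewrite -[(k *: a + b) x]/(k *: a x + b x) -[(k *: a + b) y]/(k *: a y + b y)
     !scalerDr !scalerA [s * k]mulrC addrACA.
by exists (`|k| * r + l); apply: op_boundD => //; apply: op_boundZ.
Qed.

Lemma is_adjoint_sym a b : is_adjoint a b -> is_adjoint b a.
Proof. by move=> ab x y; rewrite hdotC -ab -hdotC. Qed.

Lemma is_adjoint_uniq a b c : is_adjoint a b -> is_adjoint a c -> b = c.
Proof.
move=> ab ac; apply/funext => x; apply: hdot_ext => y.
by rewrite hdotC -ab ac -hdotC.
Qed.

Lemma is_adjoint_comp a a' b b' :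
  is_adjoint a a' -> is_adjoint b b' -> is_adjoint (a \o b) (b' \o a').
Proof. by move=> aa bb x y /=; rewrite aa bb. Qed.

Lemma is_adjoint_lin k a a' b b' :
  is_adjoint a a' -> is_adjoint b b' -> is_adjoint (k *: a + b) (k^* *: a' + b').
Proof.
move=> aa bb x y; rewrite -[(k *: a + b) x]/(k *: a x + b x).
rewrite -[(_ *: a' + b') y]/(_ *: a' y + b' y).
by rewrite hdotDl hdotDr hdotZl hdotZr conjCK aa bb.
Qed.

Lemma is_adjoint_linear a b : is_adjoint a b -> linear b.
Proof.
move=> /is_adjoint_sym ab k x y; apply: hdot_ext => z.
by rewrite ab hdotDl hdotZl -!ab -hdotZl -hdotDl.
Qed.

Lemma op_bound_adjoint a b k : is_adjoint a b -> op_bound a k -> op_bound b k.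
Proof.
move=> ab [k0 ak]; split=> // x.
have [->|bx] := eqVneq (b x) 0; first by rewrite normr0 mulr_ge0.
rewrite -(@ler_pM2l _ `|b x|) ?normr_gt0 // -expr2 hdotE -ab.
rewrite -(ger0_norm (_ : 0 <= hdot (a (b x)) x)); last by rewrite ab hdot_ge0.
apply: le_trans (CauchySchwarz_hdot _ _) _; rewrite mulrA ler_wpM2r //.
by rewrite mulrC.
Qed.

Lemma bounded_op_adjoint a b : is_adjoint a b -> bounded_op a -> bounded_op b.
Proof.
move=> ab /bounded_opP[_ [k ak]]; apply/bounded_opP; split.
  exact: is_adjoint_linear ab.
by exists k; apply: op_bound_adjoint ab _.
Qed.

Let lt02 : 0 < 2 :> C. Proof. exact: ltr0n. Qed.

Lemma eps_eq0 (V : normedModType C) (v : V) k :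
  (forall e, 0 < e -> `|v| <= k * e) -> v = 0.
Proof.
move=> h; apply/eqP; rewrite -normr_eq0; apply: contraT => v0.
have vgt0 : 0 < `|v| by rewrite lt_def v0 normr_ge0.
have k_gt0 : 0 < k by have := lt_le_trans vgt0 (h 1 ltr01); rewrite mulr1.
have := h (`|v| / (2 * k)) (divr_gt0 vgt0 (mulr_gt0 lt02 k_gt0)).
have -> : k * (`|v| / (2 * k)) = `|v| / 2.
  by field; rewrite gt_eqF.
by rewrite ler_pdivlMr ?ltr0n // mulr_natr mulr2n gerDl => /(lt_le_trans vgt0);
   rewrite ltxx.
Qed.

Definition op_close a b e := forall x, `|a x - b x| <= e * `|x|.

Lemma approx_adjoint a a' :
  (forall e, 0 < e -> exists b b', [/\ is_adjoint b b', op_close a b e & op_close a' b' e]) ->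
  is_adjoint a a'.
Proof.
move=> h x y; apply/eqP; rewrite -subr_eq0; apply/eqP.
apply: (@eps_eq0 C^o _ (2 * `|x| * `|y|)) => e e0.
have [b [b' [bb ab ab']]] := h e e0.
have -> : hdot (a x) y - hdot x (a' y) = hdot (a x - b x) y - hdot x (a' y - b' y).
  by rewrite hdotBl hdotBr bb; ring.
apply: le_trans (ler_normB _ _) _.
have -> : 2 * `|x| * `|y| * e = (e * `|x|) * `|y| + `|x| * (e * `|y|) by ring.
by apply: lerD; apply: le_trans (CauchySchwarz_hdot _ _) _;
  rewrite ?ler_wpM2r ?ler_wpM2l.
Qed.

Lemma approx_comm a t : linear t -> (exists k, op_bound t k) ->
  (forall e, 0 < e -> exists2 b, b \o t = t \o b & op_close a b e) ->
  a \o t = t \o a.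
Proof.
move=> lt [k [k0 tk]] h; apply/funext => x /=; apply/eqP; rewrite -subr_eq0; apply/eqP.
apply: (@eps_eq0 _ _ (2 * k * `|x|)) => e e0; have [b bt ab] := h e e0.
have -> : a (t x) - t (a x) = (a (t x) - b (t x)) - t (a x - b x).
  rewrite (linear_opB _ _ lt) -[b (t x)]/((b \o t) x) bt /=.
  by rewrite opprB addrA subrK.
apply: le_trans (ler_normB _ _) _.
have -> : 2 * k * `|x| * e = e * (k * `|x|) + k * (e * `|x|) by ring.
apply: lerD; first by apply: le_trans (ab _) _; rewrite ler_pM2l.
by apply: le_trans (tk _) _; rewrite ler_wpM2l.
Qed.

(** Completeness of the bounded operators in norm: the limit exists pointwise, and the Cauchy
    estimate, uniform in [x], survives the limit. *)
Lemma op_complete (b : nat -> H -> H) : (forall n, bounded_op (b n)) ->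
  (forall e, 0 < e -> exists N, forall m n, (N <= m)%N -> (N <= n)%N ->
     op_close (b m) (b n) e) ->
  exists2 a, bounded_op a & forall e, 0 < e ->
    exists N, forall n, (N <= n)%N -> op_close a (b n) e.
Proof.
move=> bb cau.
have cvb x : cvg (b n x @[n --> \oo]).
  apply/cauchy_cvgP; apply: cauchy_exP => e e0.
  have x0 : 0 < `|x| + 1 by rewrite (lt_le_trans ltr01) // lerDr.
  have [N hN] := cau _ (divr_gt0 e0 (mulr_gt0 lt02 x0)).
  exists (b N x); exists N => //= n Nn; rewrite -ball_normE /=.
  apply: le_lt_trans (hN _ _ (leqnn N) Nn x) _.
  rewrite mulrAC ltr_pdivrMr ?(mulr_gt0 _ x0) // ltr_pM2l //.
  by rewrite mulr_natl mulr2n -addrA ltrDl addr_gt0.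
pose a x : H := lim (b n x @[n --> \oo]).
have la : linear a.
  move=> k x y; apply: cvg_lim => //.
  rewrite (_ : (fun n => _) = (fun n => k *: b n x + b n y)); last first.
    by apply/funext => n; have [lb _] := bb n; rewrite lb.
  apply: cvgD; last exact: cvb.
  by apply: cvgZl_tmp; exact: cvb.
have ab e : 0 < e -> exists N, forall n, (N <= n)%N -> op_close a (b n) e.
  move=> e0; have [N hN] := cau _ (divr_gt0 e0 lt02).
  exists N => n Nn x; have [->|x0] := eqVneq x 0.
    have [lb _] := bb n.
    by rewrite (linear_op0 la) (linear_op0 lb) subr0 normr0 mulr0.
  have ex0 : 0 < e / 2 * `|x| by rewrite !mulr_gt0 ?invr_gt0 ?normr_gt0 ?ltr0n.
  have /cvgrPdist_le/(_ _ ex0)[M _ hM] : b n x @[n --> \oo] --> a x by exact: cvb.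
  have := hM (maxn M N) (leq_maxl _ _); have := hN _ _ (leq_maxr M N) Nn x => /=.
  move=> h1 h2; rewrite -(subrKA (b (maxn M N) x)).
  apply: le_trans (ler_normD _ _) _; apply: le_trans (lerD h2 h1) _.
  by rewrite -mulrDl -splitr.
exists a => //; apply/bounded_opP; split=> //.
have [N hN] := ab 1 ltr01; have /bounded_opP[_ [k [k0 kb]]] := bb N.
exists (1 + k); split=> [|x]; first by rewrite addr_ge0.
rewrite -(subrK (b N x) (a x)); apply: le_trans (ler_normD _ _) _.
by rewrite mulrDl; apply: lerD; [apply: hN | apply: kb].
Qed.

End HilbertOperators.

(** * Square roots of positive operators and Schur's lemma *)

Section Schur.
Variables (R : realType) (H : hilbert R).
Local Notation C := R[i].
Implicit Types (x y z v : H) (a b c t : H -> H) (k e : C).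

(* The scalar majorant of the iteration [r <- (x + r^2) / 2] for [1 - sqrt (1 - x)]. *)
Fixpoint sqrt_scalar (n : nat) : R :=
  if n is m.+1 then (1 + sqrt_scalar m ^+ 2) / 2 else 0.

(** In terms of [d = 1 - sqrt_scalar n] the recursion is [d - d ^+ 2 / 2], which keeps [d] below
    [2 / (n + 2)]. Convergence to 1 is what makes the operator iteration Cauchy in norm. *)
Lemma sqrt_scalar_bounds n :
  [/\ 0 <= sqrt_scalar n, sqrt_scalar n <= 1 & 1 - sqrt_scalar n <= 2 / (n%:R + 2)].
Proof.
elim: n => [|n [c0 c1 cn]] /=.
  by split=> //; rewrite subr0 add0r divff ?pnatr_eq0.
set c := sqrt_scalar n in c0 c1 cn *.
have c2 : 0 <= c ^+ 2 by rewrite sqr_ge0.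
have cc : 0 <= c * (1 - c) by rewrite mulr_ge0 // subr_ge0.
split; [lra|nra|].
have n0 : 0 <= n%:R :> R by [].
have [N0 N1] : 0 < n%:R + 2 :> R /\ 0 < n%:R + 1 + 2 :> R by lra.
rewrite -[n.+1%:R]natr1; move: cn; rewrite !ler_pdivlMr // => cn.
have := mulr_ge0 c0 (_ : 0 <= 2 - (1 - c) * (n%:R + 2)); rewrite subr_ge0 => /(_ cn).
by have := sqr_ge0 (1 - c); lra.
Qed.

Section SquareRoot.
Variable x0 : H -> H.
Hypothesis x0_lin : linear x0.
Hypothesis x0_sa : is_adjoint x0 x0.
Hypothesis x0_le1 : op_bound x0 1.

Fixpoint sqrt_iter (n : nat) : H -> H :=
  if n is m.+1 then (2^-1 : C) *: (x0 + (sqrt_iter m \o sqrt_iter m)) else (fun=> 0).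
Local Notation r := sqrt_iter.

Lemma sqrt_iterS n v : r n.+1 v = (2^-1 : C) *: (x0 v + r n (r n v)).
Proof. by []. Qed.

Lemma sqrt_iter_linear n : linear (r n).
Proof.
elim: n => [|n IH] k x y; first by rewrite /= scaler0 addr0.
rewrite !sqrt_iterS x0_lin !IH scalerA [k * _]mulrC -scalerA -scalerDr.
by congr (_ *: _); rewrite scalerDr addrACA.
Qed.

Lemma sqrt_iter_sa n : is_adjoint (r n) (r n).
Proof.
elim: n => [|n IH] x y; first by rewrite /= hdot0l hdot0r.
rewrite !sqrt_iterS hdotZl hdotZr hdotDl hdotDr x0_sa !IH.
by rewrite fmorphV rmorph_nat.
Qed.

Lemma sqrt_iter_bound n : op_bound (r n) (sqrt_scalar n)%:C%C.
Proof.
elim: n => [|n IH]; first by split=> // x; rewrite normr0 mul0r.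
rewrite (_ : _%:C%C = `|2^-1| * (1 + (sqrt_scalar n)%:C%C * (sqrt_scalar n)%:C%C)).
  by apply/op_boundZ/op_boundD => //; apply: op_bound_comp.
by rewrite ger0_norm ?invr_ge0 ?ler0n // -rmorphM /= rmorphM rmorphD rmorph1
  fmorphV rmorph_nat expr2 mulrC.
Qed.

Lemma sqrt_iter_bounded n : bounded_op (r n).
Proof.
apply/bounded_opP; split; first exact: sqrt_iter_linear.
by exists (sqrt_scalar n)%:C%C; apply: sqrt_iter_bound.
Qed.

Lemma sqrt_iter_comm t n : linear t -> x0 \o t = t \o x0 -> r n \o t = t \o r n.
Proof.
move=> lt xt; elim: n => [|n IH]; apply/funext => v.
  by rewrite /= (linear_op0 lt).
have IHv w : r n (t w) = t (r n w) by rewrite -[LHS]/((r n \o t) w) IH.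
have xtv : x0 (t v) = t (x0 v) by rewrite -[LHS]/((x0 \o t) v) xt.
by rewrite -[LHS]/(r n.+1 (t v)) -[RHS]/(t (r n.+1 v)) !sqrt_iterS xtv !IHv (linear_opZ _ _ lt)
  (linear_opD _ _ lt).
Qed.

Lemma sqrt_iter_commr m n : r m \o r n = r n \o r m.
Proof.
have xr (l : nat) : x0 \o r l = r l \o x0 by rewrite (sqrt_iter_comm _ x0_lin).
by rewrite (sqrt_iter_comm m (sqrt_iter_linear n) (xr n)).
Qed.

(** Consecutive iterates commute, so the next difference is half of [r n.+1 + r n] composed with
    [r n.+1 - r n]. The scalar sequence obeys the same recursion, and the bounds propagate. *)
Lemma sqrt_iter_step n :
  op_bound (r n.+1 - r n) (sqrt_scalar n.+1 - sqrt_scalar n)%:C%C.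
Proof.
elim: n => [|n IH].
  have := sqrt_iter_bound 1; congr (op_bound _ _).
    by apply/funext => v /=; rewrite [RHS]subr0.
  by rewrite /= subr0.
have -> : r n.+2 - r n.+1 = (2^-1 : C) *: ((r n.+1 + r n) \o (r n.+1 - r n)).
  apply/funext => v; rewrite -[LHS]/((2^-1 : C) *: (x0 v + r n.+1 (r n.+1 v)) -
    (2^-1 : C) *: (x0 v + r n (r n v))) -scalerBr; congr (_ *: _).
  rewrite -[RHS]/(r n.+1 (r n.+1 v - r n v) + r n (r n.+1 v - r n v)).
  rewrite !(linear_opB _ _ (sqrt_iter_linear _)).
  rewrite -[r n (r n.+1 v)]/((r n \o r n.+1) v) sqrt_iter_commr /=.
  by rewrite opprD addrACA subrr add0r addrA subrK.
rewrite (_ : _%:C%C = `|2^-1| * (((sqrt_scalar n.+1)%:C%C + (sqrt_scalar n)%:C%C) *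
   (sqrt_scalar n.+1 - sqrt_scalar n)%:C%C)).
  by apply/op_boundZ/op_bound_comp => //; apply: op_boundD; apply: sqrt_iter_bound.
rewrite ger0_norm ?invr_ge0 ?ler0n // -rmorphD -rmorphM.
have -> : 2^-1 = (2^-1 : R)%:C%C :> C by rewrite fmorphV rmorph_nat.
by rewrite -rmorphM; congr (_%:C%C) => /=; field.
Qed.

Lemma sqrt_iter_close m n : (n <= m)%N ->
  op_close (r m) (r n) (sqrt_scalar m - sqrt_scalar n)%:C%C.
Proof.
move=> /subnK <-; elim: (m - n)%N => [|p IH] v; first by rewrite !subrr normr0 mul0r.
rewrite addSn -(subrKA (r (p + n) v)); apply: le_trans (ler_normD _ _) _.
apply: (@le_trans _ _ ((sqrt_scalar (p + n).+1 - sqrt_scalar (p + n))%:C%C * `|v|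
   + (sqrt_scalar (p + n) - sqrt_scalar n)%:C%C * `|v|)).
  by apply: lerD => //; apply: (sqrt_iter_step _).2.
by rewrite -mulrDl -rmorphD /= addrA subrK.
Qed.

(** The norm limit [q] of the iterates satisfies [2 q = x0 + q^2], that is [(1 - q)^2 = 1 - x0], and
    [s = 1 - q] is positive because [q] is a contraction. The last clause holds since each iterate
    commutes with whatever commutes with [x0]. *)
Lemma sqrt_one_sub : exists s, [/\ bounded_op s, is_adjoint s s,
  forall v, 0 <= hdot (s v) v, forall v, s (s v) = v - x0 v &
  forall t, bounded_op t -> x0 \o t = t \o x0 -> s \o t = t \o s].
Proof.
have small e : 0 < e -> exists N, forall m n, (N <= m)%N -> (N <= n)%N ->
     op_close (r m) (r n) e.
  case: e => e e'; rewrite ltcE /= => /andP[/eqP -> e0].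
  have [N Ne] : exists N : nat, 2 / (N%:R + 2) <= e.
    exists (Num.bound (2 / e)); rewrite ler_pdivrMr ?ltr_wpDl //.
    have := archi_boundP (ltW (divr_gt0 (ltr0n _ 2) e0)).
    rewrite ltr_pdivrMr // => /ltW h; rewrite mulrDr mulrC.
    by apply: le_trans h _; rewrite lerDl mulr_ge0 ?ltW.
  have close (m n : nat) : (N <= n)%N -> (n <= m)%N -> op_close (r m) (r n) e%:C%C.
    move=> Nn nm v; apply: le_trans (sqrt_iter_close nm v) _.
    rewrite ler_wpM2r // lecR; apply: le_trans _ Ne.
    have [_ m1 _] := sqrt_scalar_bounds m; have [_ _ n1] := sqrt_scalar_bounds n.
    apply: le_trans (_ : 1 - sqrt_scalar n <= _); first by rewrite lerD2r.
    apply: le_trans n1 _; rewrite ler_pM2l ?ltr0n // lef_pV2 ?posrE ?ltr_wpDl //.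
    by rewrite lerD2r ler_nat.
  exists N => m n Nm Nn; have [nm|/ltnW mn] := leqP n m; first exact: close.
  by move=> v; rewrite distrC; apply: close.
have r1 N w : `|r N w| <= `|w|.
  apply: le_trans ((sqrt_iter_bound N).2 w) _; rewrite ler_piMl //.
  by have [_ c1 _] := sqrt_scalar_bounds N; rewrite -[1]/(1%:C%C) lecR.
have [q qb qr] := op_complete sqrt_iter_bounded small.
have [ql [k qk]] := (bounded_opP _).1 qb.
have q_sa : is_adjoint q q.
  apply: approx_adjoint => e e0; have [N hN] := qr e e0.
  by exists (r N), (r N); split; [apply: sqrt_iter_sa | apply: hN | apply: hN].
have q_eq v : 2 *: q v = x0 v + q (q v).
  apply/eqP; rewrite -subr_eq0; apply/eqP.
  apply: (@eps_eq0 _ _ _ ((4 + k) * `|v|)) => e e0; have [N hN] := qr e e0.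
  have -> : 2 *: q v - (x0 v + q (q v)) = 2 *: (q v - r N.+1 v) -
      (q (q v - r N v) + (q (r N v) - r N (r N v))).
    rewrite sqrt_iterS scalerBr scalerA divff ?pnatr_eq0 // scale1r.
    rewrite (linear_opB _ _ ql) subrKA.
    by rewrite !opprD !opprK !addrA [RHS]addrAC subrK.
  apply: le_trans (ler_normB _ _) _.
  rewrite normrZ ger0_norm ?ler0n //.
  have [k0 kb] := qk.
  have -> : (4 + k) * `|v| * e = 2 * (e * `|v|) + (k * (e * `|v|) + 2 * (e * `|v|)) by ring.
  apply: lerD; first by rewrite ler_pM2l ?ltr0n //; apply: hN.
  apply: le_trans (ler_normD _ _) _; apply: lerD.
    by apply: le_trans (kb _) _; rewrite ler_wpM2l //; apply: hN.
  apply: le_trans (hN _ (leqnn N) _) _.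
  rewrite mulrCA ler_pM2l //; apply: le_trans (r1 N v) _.
  by rewrite ler_peMl // ler1n.
have q_comm t : bounded_op t -> x0 \o t = t \o x0 -> q \o t = t \o q.
  move=> /bounded_opP[lt tb] xt; apply: approx_comm => // e e0.
  have [N hN] := qr e e0; exists (r N); last exact: hN.
  exact: sqrt_iter_comm.
have q_le v : `|q v| <= `|v|.
  apply/ler_addgt0Pr => e e0; have v0 : 0 < `|v| + 1.
    by rewrite (lt_le_trans ltr01) // lerDr.
  have [N hN] := qr _ (divr_gt0 e0 v0).
  rewrite addrC -[q v](subrK (r N v)); apply: le_trans (ler_normD _ _) _.
  apply: lerD; last exact: r1.
  apply: le_trans (hN _ (leqnn N) v) _.
  by rewrite mulrAC ler_pdivrMr // ler_pM2l // lerDl.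
pose s v := v - q v.
have sl : linear s.
  by move=> c x y; rewrite /s ql scalerBr opprD addrACA.
exists s; split.
- apply/bounded_opP; split=> //; exists (1 + k).
  have [k0 kb] := qk; split=> [|x]; first by rewrite addr_ge0.
  by apply: le_trans (ler_normB _ _) _; rewrite mulrDl mul1r lerD.
- by move=> x y; rewrite /s hdotBl hdotBr q_sa.
- move=> v; rewrite /s hdotBl subr_ge0.
  have qreal : hdot (q v) v \is Num.real by apply/CrealP; rewrite -hdotC q_sa.
  apply: le_trans (real_ler_norm qreal) _; apply: le_trans (CauchySchwarz_hdot _ _) _.
  by rewrite -hdotE expr2 ler_wpM2r.
- move=> v; rewrite /s (linear_opB _ _ ql).
  have -> : q (q v) = 2 *: q v - x0 v by rewrite q_eq addrC addKr.
  rewrite scaler_nat mulr2n -[q v + q v - _]addrA opprB.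
  by rewrite [_ - q v in X in _ + X]addrAC subrr add0r addrA subrK.
- move=> t tb xt; apply/funext => v; rewrite /s /=.
  rewrite -[q (t v)]/((q \o t) v) q_comm // (linear_opB _ _ (bounded_op_linear tb)).
  by [].
Qed.

End SquareRoot.

Definition irreducible_family (S : set (H -> H)) : Prop :=
  forall W : set H, W 0 -> (forall k x y, W x -> W y -> W (k *: x + y)) ->
    closed W -> (forall a x, S a -> W x -> W (a x)) ->
    W = [set 0] \/ W = setT.

Variable S : set (H -> H).
Hypothesis S_bounded : forall a, S a -> bounded_op a.
Hypothesis S_irr : irreducible_family S.

(* A kernel of an operator commuting with [S] is closed and invariant. *)
Lemma ker_trivial t : bounded_op t -> (forall a, S a -> a \o t = t \o a) ->
  (exists2 v, v != 0 & t v = 0) -> forall v, t v = 0.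
Proof.
move=> [lt ct] comm [v v0 tv0] w; pose K : set H := [set u | t u = 0].
have /(_ _ _ _ _)[||||K0|KT] := @S_irr K.
- exact: linear_op0.
- by move=> k x y tx ty; rewrite /K /= lt tx ty scaler0 addr0.
- apply: (@preimage_closed _ _ t [set 0]) => //.
  exact/accessible_closed_set1/hausdorff_accessible/norm_hausdorff.
- move=> a x Sa tx; rewrite /K /= -[t (a x)]/((t \o a) x) -comm //=.
  by rewrite [t x]tx (linear_op0 (bounded_op_linear (S_bounded Sa))).
- by have : K v by []; rewrite K0 => /eqP; rewrite (negPf v0).
- by have : K w by rewrite KT.
Qed.

(* With [s] the square root of [t^2], [(s - t) (s + t) = 0]: by irreducibility the kernel
   of [s - t] is everything, or [s + t = 0]. *)
Lemma commutant_sign t : bounded_op t -> is_adjoint t t ->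
  (forall a, S a -> a \o t = t \o a) ->
  (forall v, 0 <= hdot (t v) v) \/ (forall v, hdot (t v) v <= 0).
Proof.
move=> bt; have [lt0 [k0 [k0_ge0 t0k]]] := (bounded_opP _).1 bt.
wlog tk : t {bt} lt0 {k0 k0_ge0 t0k} / op_bound t 1.
  move=> gen t_sa comm; pose l := (k0 + 1)^-1.
  have k_gt0 : 0 < k0 + 1 by rewrite ltr_wpDl.
  have l_gt0 : 0 < l by rewrite invr_gt0.
  have lr : l^* = l by apply/CrealP/ger0_real/ltW.
  have [||||p|p] := gen (fun v => l *: t v).
  + by move=> c x y; rewrite lt0 scalerDr !scalerA mulrC.
  + split=> // x; rewrite normrZ gtr0_norm // mul1r ler_pdivrMl //.
    by apply: le_trans (t0k x) _; rewrite ler_wpM2r // lerDl.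
  + by move=> x y; rewrite hdotZl hdotZr t_sa lr.
  + move=> a Sa; apply/funext => x /=.
    rewrite (linear_opZ _ _ (bounded_op_linear (S_bounded Sa))).
    by rewrite -[a (t x)]/((a \o t) x) comm.
  + by left=> v; have := p v; rewrite hdotZl pmulr_rge0.
  + by right=> v; have := p v; rewrite hdotZl pmulr_rle0.
move=> t_sa comm; have bt : bounded_op t by apply/bounded_opP; split=> //; exists 1.
have t1 x : `|t x| <= `|x| by have := tk.2 x; rewrite mul1r.
(* [sqrt_one_sub] gives a root of [1 - x0], here of [t^2]. It wants [x0] to be a contraction, whence
   the rescaling of [t]. *)
pose x0 v := v - t (t v).
have x0l : linear x0 by move=> c x y; rewrite /x0 !lt0 scalerBr opprD addrACA.
have x0_sa : is_adjoint x0 x0 by move=> x y; rewrite /x0 hdotBl hdotBr !t_sa.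
have x0_1 : op_bound x0 1.
  split=> // v; rewrite mul1r -(@ler_pXn2r _ 2) ?nnegrE // !hdotE /x0.
  have e1 : hdot v (t (t v)) = `|t v| ^+ 2 by rewrite -t_sa hdotE.
  have e2 : hdot (t (t v)) v = `|t v| ^+ 2 by rewrite t_sa hdotE.
  rewrite hdotBl !hdotBr e1 e2 -!hdotE.
  have : `|t (t v)| ^+ 2 <= `|t v| ^+ 2 by rewrite ler_pXn2r ?nnegrE.
  have : 0 <= `|t v| ^+ 2 by rewrite exprn_ge0.
  set p := `|t v| ^+ 2; set q := `|t (t v)| ^+ 2; set w := `|v| ^+ 2 => p0 qp.
  rewrite -subr_ge0 (_ : _ - _ = p + (p - q)); last by ring.
  by rewrite addr_ge0 // subr_ge0.
have [s [bs s_sa s_ge0 ss s_comm]] := sqrt_one_sub x0l x0_sa x0_1.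
have x0_comm a : bounded_op a -> a \o t = t \o a -> x0 \o a = a \o x0.
  move=> [la _] at_; apply/funext => v; rewrite /x0 /= (linear_opB _ _ la).
  have E u : a (t u) = t (a u) by rewrite -[LHS]/((a \o t) u) at_.
  by rewrite !E.
have st v : s (t v) = t (s v).
  by rewrite -[LHS]/((s \o t) v) s_comm // x0_comm.
have sa a : S a -> a \o s = s \o a.
  by move=> Sa; rewrite s_comm ?x0_comm ?comm //; apply: S_bounded.
have [ls _] := bs.
pose d := (-1 : C) *: t + s.
have dE v : d v = s v - t v by rewrite -[d v]/((-1) *: t v + s v) scaleN1r addrC.
have bd : bounded_op d by apply: bounded_op_lin.
have d_comm a : S a -> a \o d = d \o a.
  move=> Sa; apply/funext => v; rewrite /= !dE.
  rewrite (linear_opB _ _ (bounded_op_linear (S_bounded Sa))).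
  by rewrite -[a (s v)]/((a \o s) v) sa // -[a (t v)]/((a \o t) v) comm.
have dst v : d (s v + t v) = 0.
  rewrite dE (linear_opD _ _ ls) (linear_opD _ _ lt0) st ss /x0.
  by rewrite opprB addrCA subrr addr0 opprD addrA addrK subrr.
have [[v nz]|z] := pselect (exists v, s v + t v != 0).
  left=> w; have /eqP : d w = 0 by apply: ker_trivial w => //; exists (s v + t v).
  by rewrite dE subr_eq0 => /eqP <-; apply: s_ge0.
right=> w; have : s w + t w = 0.
  by apply/eqP; apply: contra_notT z => nz; exists w.
by rewrite addrC => /eqP; rewrite addr_eq0 => /eqP ->; rewrite hdotNl oppr_le0 s_ge0.
Qed.

(* [u = t - k] is semidefinite, so [hdot (u v0) v0 = 0] forces [u v0 = 0] by the
   Cauchy-Schwarz inequality, and the kernel of [u] is then everything. *)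
Lemma schur_selfadjoint t : bounded_op t -> is_adjoint t t ->
  (forall a, S a -> a \o t = t \o a) -> exists k, forall v, t v = k *: v.
Proof.
move=> bt t_sa comm; have [[v0 nz]|z] := pselect (exists v : H, v != 0); last first.
  exists 0 => v; rewrite scale0r; apply/eqP.
  by apply: contra_notT z => nz; exists (t v).
pose k := hdot (t v0) v0 / hdot v0 v0.
have n0 : hdot v0 v0 != 0 by rewrite -hdotE sqrf_eq0 normr_eq0.
have kr : k^* = k.
  by apply/CrealP; rewrite rpred_div //; apply/CrealP; rewrite -hdotC ?t_sa.
pose u := (- k) *: idfun + t.
have uE v : u v = t v - k *: v.
  by rewrite -[u v]/((- k) *: v + t v) scaleNr addrC.
have bu : bounded_op u by apply: bounded_op_lin => //; apply: bounded_op_id.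
have u_sa : is_adjoint u u.
  by move=> x y; rewrite !uE hdotBl hdotBr hdotZl hdotZr kr t_sa.
have u_comm a : S a -> a \o u = u \o a.
  move=> Sa; have la := bounded_op_linear (S_bounded Sa); apply/funext => v.
  by rewrite /= !uE (linear_opB _ _ la) (linear_opZ _ _ la)
     -[a (t v)]/((a \o t) v) comm.
have uv0 : hdot (u v0) v0 = 0.
  by rewrite uE hdotBl hdotZl /k divfK // subrr.
have lu := bounded_op_linear bu.
have u0 : u v0 = 0.
  have expand (z : C) w : hdot (u (v0 + z *: w)) (v0 + z *: w) =
      0 + z * hdot (u w) v0 + z^* * hdot (u v0) w + z * z^* * hdot (u w) w.
    rewrite (linear_opD _ _ lu) (linear_opZ _ _ lu) hdotDl !hdotDr.
    by rewrite !hdotZl !hdotZr uv0; ring.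
  suff uw w : hdot (u w) v0 = 0.
    by apply: hdot_ext => w; rewrite u_sa hdotC uw conjC0 hdot0l.
  apply/eqP; rewrite -normr_eq0 -sqrf_eq0 eq_le exprn_ge0 // andbT.
  have [p|p] := commutant_sign bu u_sa u_comm.
    rewrite -(mul0r (hdot (u w) w)).
    by apply: (@sesqui_discriminant _ _ _ (hdot (u v0) w)) => z; rewrite -expand.
  rewrite -(mul0r (- hdot (u w) w)) -normrN.
  apply: (@sesqui_discriminant _ _ _ (- hdot (u v0) w)) => z.
  have := p (v0 + z *: w); rewrite expand -oppr_ge0; congr (_ <= _); ring.
exists k => v; apply/eqP; rewrite -subr_eq0 -uE; apply/eqP.
by apply: ker_trivial v => //; exists v0.
Qed.

(** The operators [t + t'] and ['i *: (t - t')] are self-adjoint, twice the real part and minus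
    twice the imaginary part of [t]. They lie in the commutant because both [t] and [t'] do. *)
Lemma schur t t' : bounded_op t -> is_adjoint t t' ->
  (forall a, S a -> a \o t = t \o a) -> (forall a, S a -> a \o t' = t' \o a) ->
  exists k, forall v, t v = k *: v.
Proof.
move=> bt tt' comm comm'; have bt' := bounded_op_adjoint tt' bt.
pose p := 1 *: t + t'; pose q := (- 'i) *: t + 'i *: t'.
have pE v : p v = t v + t' v by rewrite -[p v]/(1 *: t v + t' v) scale1r.
have [k1 k1E] : exists k, forall v, p v = k *: v.
  apply: schur_selfadjoint.
  - exact: bounded_op_lin.
  - by move=> x y; rewrite !pE hdotDl hdotDr tt' (is_adjoint_sym tt') addrC.
  move=> a Sa; have la := bounded_op_linear (S_bounded Sa); apply/funext => v.
  by rewrite /= !pE (linear_opD _ _ la) -[a (t v)]/((a \o t) v) comm //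
    -[a (t' v)]/((a \o t') v) comm'.
pose w v := 'i *: (t v - t' v).
have [k2 k2E] : exists k, forall v, w v = k *: v.
  have wl : w = (- 'i) *: t' + ('i *: t + (fun=> 0)).
    apply/funext => v; rewrite -[RHS]/((- 'i) *: t' v + ('i *: t v + 0)).
    by rewrite addr0 scaleNr addrC -scalerBr.
  apply: schur_selfadjoint.
  - rewrite wl; do 2?apply: bounded_op_lin => //.
    by apply/bounded_opP; split=> [c x y|]; [rewrite scaler0 addr0 | exists 0;
      split=> // x; rewrite normr0 mul0r].
  - move=> x y; rewrite /w hdotZl hdotZr conjCi hdotBl hdotBr tt' (is_adjoint_sym tt').
    by rewrite mulNr -mulrN opprB.
  move=> a Sa; have la := bounded_op_linear (S_bounded Sa); apply/funext => v.
  by rewrite /= /w (linear_opZ _ _ la) (linear_opB _ _ la) -[a (t v)]/((a \o t) v) comm //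
    -[a (t' v)]/((a \o t') v) comm'.
exists (2^-1 * (k1 - 'i * k2)) => v.
rewrite -scalerA scalerBl -k1E -scalerA -k2E pE /w scalerA -expr2 sqrCi scaleN1r opprK.
by rewrite addrACA subrr addr0 -mulr2n -[t v *+ 2]scaler_nat scalerA mulVf ?pnatr_eq0 // scale1r.
Qed.

End Schur.

(** * Diagonal values of an isometry *)

Section NumericalRadius.
Variables (R : realType) (H : hilbert R).
Local Notation C := R[i].

(* Polarization: the four vectors [V v + c *: v], [c ^+ 4 = 1], recover [hdot (V v) (V v)]. *)
Lemma isometry_numerical_radius (V : H -> H) (v : H) : linear V ->
  (forall x y, hdot (V x) (V y) = hdot x y) -> `|v| = 1 ->
  exists2 x, `|x| <= 2 & 1 <= `|hdot (V x) x|.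
Proof.
move=> lV dV v1; pose y := V v.
have y1 : `|y| = 1.
  by apply/eqP; rewrite -(@eqrXn2 _ 2) // expr1n hdotE dV -hdotE v1 expr1n.
pose x (k : C) := y + k *: v; pose f k := hdot (V (x k)) (x k).
have x2 k : `|k| = 1 -> `|x k| <= 2.
  move=> k1; apply: le_trans (ler_normD _ _) _.
  by rewrite normrZ k1 v1 y1 mul1r.
have fE k : f k = hdot (V y) y + k * hdot (V v) y + k^* * hdot (V y) v
    + k * k^* * hdot (V v) v.
  rewrite /f /x (linear_opD _ _ lV) (linear_opZ _ _ lV) hdotDl !hdotDr.
  by rewrite !hdotZl !hdotZr; ring.
have i2 : 'i * 'i = -1 :> C by rewrite -expr2 sqrCi.
have f4 : f 1 - 'i * f 'i - f (-1) + 'i * f (- 'i) = 4.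
  have cm1 : (-1 : C)^* = -1 by rewrite rmorphN rmorph1.
  have cmi : (- 'i : C)^* = 'i by rewrite rmorphN /= conjCi opprK.
  rewrite !fE cm1 cmi conjCi conjC1.
  have -> : hdot (V v) y = 1 by rewrite -/y -hdotE y1 expr1n.
  set a := hdot (V y) y; set b := hdot (V y) v; set d := hdot (V v) v.
  move: i2; set z : C := 'i => i2.
  transitivity (2 + 2 * b - 2 * (z * z) + 2 * (z * z) * b); first by ring.
  by rewrite i2; ring.
(* Otherwise all four diagonal values have modulus below 1, and their combination in [f4] could not
   reach 4. *)
apply: contrapT => nex.
have f_lt1 k : `|k| = 1 -> `|f k| < 1.
  move=> k1; rewrite real_ltNge ?normr_real //; apply/negP => fk.
  by apply: nex; exists (x k) => //; apply: x2.
have ni : `|'i| = 1 :> C.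
  by apply/eqP; rewrite -(@eqrXn2 _ 2) // expr1n -normrX sqrCi normrN normr1.
have : `|f 1 - 'i * f 'i - f (-1) + 'i * f (- 'i)| < 1 + 1 + 1 + 1.
  apply: le_lt_trans (ler_normD _ _) _; apply: ltrD; last first.
    by rewrite normrM ni mul1r f_lt1 // normrN.
  apply: le_lt_trans (ler_normB _ _) _; apply: ltrD; last first.
    by rewrite f_lt1 // normrN normr1.
  apply: le_lt_trans (ler_normB _ _) _; apply: ltrD.
    by rewrite f_lt1 // normr1.
  by rewrite normrM ni mul1r f_lt1.
rewrite f4 ger0_norm ?ler0n // (_ : 1 + 1 + 1 + 1 = 4); last by ring.
by rewrite ltxx.
Qed.

End NumericalRadius.

(** * Star-algebras, norm closures and commutants *)

Section OperatorAlgebras.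
Variables (R : realType) (H : hilbert R).
Local Notation C := R[i].
Implicit Types (x y z v : H) (a b c t : H -> H) (k e : C) (S : set (H -> H)).

Definition star_algebra S : Prop :=
  [/\ S `<=` @bounded_op R H H, S idfun,
      forall k a b, S a -> S b -> S (k *: a + b),
      forall a b, S a -> S b -> S (a \o b) &
      adjoint_closed S].

Lemma sub_norm_closure S : S `<=` @bounded_op R H H -> S `<=` norm_closure S.
Proof.
move=> Sb a Sa; split=> [|e e0]; first exact: Sb.
by exists a => // x; rewrite subrr normr0 mulr_ge0 // ltW.
Qed.

Lemma op_close_adjoint a a' b b' e : bounded_op a -> bounded_op b -> 0 <= e ->
  is_adjoint a a' -> is_adjoint b b' -> op_close a b e -> op_close a' b' e.
Proof.
move=> ba bb e0 aa bb' ab x.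
have := is_adjoint_lin (-1) bb' aa; rewrite rmorphN rmorph1 => dd.
have [|_] := op_bound_adjoint (k := e) dd.
  split=> // y; rewrite -[(_ + _) y]/(-1 *: b y + a y).
  by rewrite scaleN1r addrC; apply: ab.
by move=> /(_ x); rewrite -[(_ + _) x]/(-1 *: b' x + a' x) scaleN1r addrC.
Qed.

Lemma inv_nat_small e : 0 < e -> exists N : nat, forall n, (N <= n)%N ->
  (n%:R + 1)^-1 <= e.
Proof.
case: e => e e'; rewrite ltcE /= => /andP[/eqP -> e0].
exists (Num.bound e^-1) => n Nn.
have n1 : 0 < n%:R + 1 :> R by rewrite ltr_wpDl.
have -> : (n%:R + 1)^-1 = ((n%:R + 1)^-1 : R)%:C%C.
  by rewrite fmorphV rmorphD rmorph_nat rmorph1.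
rewrite lecR -[e]invrK lef_pV2 ?posrE ?invr_gt0 //.
apply: le_trans (ltW (archi_boundP (ltW _))) _; rewrite ?invr_gt0 //.
by apply: (@le_trans _ _ n%:R); rewrite ?ler_nat // lerDl.
Qed.

(** The adjoints of an approximating sequence are again Cauchy, as passing to the adjoint preserves
    bounds; their limit is the adjoint of the limit. *)
Lemma norm_closure_adjoint S : S `<=` @bounded_op R H H -> adjoint_closed S ->
  adjoint_closed (norm_closure S).
Proof.
move=> Sb Sadj a [ba acl].
have n0 n : 0 < (n%:R + 1)^-1 :> C by rewrite invr_gt0 ltr_wpDl.
have /choice[b bP] n : exists b, S b /\ op_close a b (n%:R + 1)^-1.
  by have [b Sb' ab] := acl _ (n0 n); exists b.
have /choice[b' b'P] n : exists b', S b' /\ is_adjoint (b n) b'.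
  by have [b' ? ?] := Sadj _ (bP n).1; exists b'.
have close m n e : (m%:R + 1)^-1 <= e -> (n%:R + 1)^-1 <= e ->
    op_close (b' m) (b' n) (e + e).
  move=> me ne; have e0 : 0 <= e by apply: le_trans (ltW (n0 m)) me.
  apply: op_close_adjoint (b'P m).2 (b'P n).2 _; rewrite ?addr_ge0 //.
  - exact: Sb (bP m).1.
  - exact: Sb (bP n).1.
  move=> x; rewrite -(subrKA (a x)); apply: le_trans (ler_normD _ _) _.
  rewrite mulrDl; apply: lerD.
    by rewrite distrC; apply: le_trans ((bP m).2 x) _; rewrite ler_wpM2r.
  by apply: le_trans ((bP n).2 x) _; rewrite ler_wpM2r.
have [n|e e0|a' ba' a'b'] := @op_complete _ _ b'.
- exact: Sb (b'P n).1.
- have [N hN] := inv_nat_small (divr_gt0 e0 (ltr0n _ 2)).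
  exists N => m n Nm Nn; rewrite [e]splitr.
  by apply: close; apply: hN.
have aa' : is_adjoint a a'.
  apply: approx_adjoint => e e0; have [N hN] := inv_nat_small e0.
  have [M hM] := a'b' e e0; exists (b (maxn M N)), (b' (maxn M N)); split.
  - exact: (b'P _).2.
  - move=> x; apply: le_trans ((bP _).2 x) _.
    by rewrite ler_wpM2r // hN // leq_maxr.
  - by apply: hM; apply: leq_maxl.
exists a' => //; split=> // e e0; have [M hM] := a'b' e e0.
by exists (b' M); [exact: (b'P M).1 | apply: hM].
Qed.

Lemma norm_closure_lin S : S `<=` @bounded_op R H H ->
  (forall k a b, S a -> S b -> S (k *: a + b)) ->
  forall k a b, norm_closure S a -> norm_closure S b -> norm_closure S (k *: a + b).
Proof.
move=> Sb Sl k a b [ba acl] [bb bcl]; split; first exact: bounded_op_lin.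
move=> e e0; have k0 : 0 < `|k| + 1 by rewrite ltr_wpDl.
have e20 := divr_gt0 e0 (ltr0n _ 2).
have [a0 Sa aa] := acl _ (divr_gt0 e20 k0); have [b0 Sb0 bb0] := bcl _ e20.
exists (k *: a0 + b0); first exact: Sl.
move=> x; rewrite -[(k *: a + b) x]/(k *: a x + b x).
rewrite -[(k *: a0 + b0) x]/(k *: a0 x + b0 x) opprD addrACA -scalerBr.
apply: le_trans (ler_normD _ _) _; rewrite [e]splitr mulrDl lerD // normrZ.
apply: (@le_trans _ _ (`|k| * (e / 2 / (`|k| + 1) * `|x|))).
  by rewrite ler_wpM2l.
rewrite mulrA ler_wpM2r // mulrA ler_pdivrMr // mulrC ler_wpM2l ?ltW //.
by rewrite ltrDl.
Qed.

Lemma norm_closure_comp S : S `<=` @bounded_op R H H ->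
  (forall a b, S a -> S b -> S (a \o b)) ->
  forall a b, norm_closure S a -> norm_closure S b -> norm_closure S (a \o b).
Proof.
move=> Sb Sc a b [ba acl] [bb bcl]; split; first exact: bounded_op_comp.
have [la [k [k_ge0 ak]]] := (bounded_opP _).1 ba.
move=> e e0; have k0 : 0 < k + 1 by rewrite ltr_wpDl.
have e20 := divr_gt0 e0 (ltr0n _ 2).
(* [b0] is chosen before [a0], whose tolerance depends on a bound for [b0]. Adding 1 to the bounds
   keeps the denominators positive. *)
have [b0 Sb0 bb0] := bcl _ (divr_gt0 e20 k0).
have [_ [l [l_ge0 bl]]] := (bounded_opP _).1 (Sb _ Sb0).
have l0 : 0 < l + 1 by rewrite ltr_wpDl.
have [a0 Sa aa] := acl _ (divr_gt0 e20 l0).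
exists (a0 \o b0); first exact: Sc.
move=> x /=; rewrite -(subrKA (a (b0 x))) -(linear_opB _ _ la).
apply: le_trans (ler_normD _ _) _; rewrite [e]splitr mulrDl; apply: lerD.
  apply: le_trans (ak _) _; apply: (@le_trans _ _ (k * (e / 2 / (k + 1) * `|x|))).
    by rewrite ler_wpM2l.
  rewrite mulrA ler_wpM2r // mulrA ler_pdivrMr // mulrC ler_wpM2l ?ltW //.
  by rewrite ltrDl.
apply: le_trans (aa _) _; apply: (@le_trans _ _ (e / 2 / (l + 1) * (l * `|x|))).
  by rewrite ler_wpM2l // ltW ?divr_gt0.
rewrite mulrA ler_wpM2r // mulrAC ler_pdivrMr // ler_wpM2l ?ltW //.
by rewrite ltrDl.
Qed.

Lemma norm_closure_star_algebra S : star_algebra S -> star_algebra (norm_closure S).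
Proof.
move=> [Sb S1 Sl Sc Sa]; split.
- by move=> a [].
- exact: sub_norm_closure.
- exact: norm_closure_lin.
- exact: norm_closure_comp.
- exact: norm_closure_adjoint.
Qed.

Lemma cstar_star_algebra S : star_algebra S -> norm_closure S `<=` S -> cstar_algebra S.
Proof. by case=> *; split. Qed.

Lemma von_neumann_star_algebra S : von_neumann_algebra S -> star_algebra S.
Proof.
case=> Sb Sadj SE; split=> //.
- rewrite -SE; split; first exact: bounded_op_id.
  by move=> a _; apply/funext.
- move=> k a b; rewrite -{1 2 3}SE => -[ba ac] [bb bc]; split.
    exact: bounded_op_lin.
  move=> c Cc; have lc := bounded_op_linear Cc.1.
  apply/funext => x /=; rewrite -[(k *: a + b) x]/(k *: a x + b x).
  rewrite lc -[c (a x)]/((c \o a) x) ac // -[c (b x)]/((c \o b) x) bc //.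
- move=> a b; rewrite -{1 2 3}SE => -[ba ac] [bb bc]; split.
    exact: bounded_op_comp.
  move=> c Cc; apply/funext => x /=.
  by rewrite -[c (a _)]/((c \o a) _) ac //= -[c (b x)]/((c \o b) x) bc.
Qed.

(** [B] collects the operators that commute with [t] and have an adjoint doing the same; the second
    clause makes [B] closed under adjoints although [t] need not be self-adjoint. It is a C*-algebra
    containing [S]. *)
Lemma commutant_generated S t : S `<=` @bounded_op R H H -> adjoint_closed S ->
  bounded_op t -> (forall a, S a -> a \o t = t \o a) ->
  forall a, cstar_generated S a -> a \o t = t \o a.
Proof.
move=> Sb Sadj bt comm a Sa; have lt := bounded_op_linear bt.
pose B : set (H -> H) := [set a | [/\ bounded_op a, a \o t = t \o a &
  exists b, [/\ bounded_op b, is_adjoint a b & b \o t = t \o b]]].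
suff [_ //] : B a; apply: Sa; last first.
  move=> b Sb'; split; [exact: Sb | exact: comm | have [b' Sb'' bb'] := Sadj _ Sb'].
  by exists b'; split; [exact: Sb | | exact: comm].
have Bb : B `<=` @bounded_op R H H by move=> b [].
have Badj : adjoint_closed B.
  move=> b [bb bt' [b' [bb' adj b't]]]; exists b' => //; split=> //.
  by exists b; split=> //; apply: is_adjoint_sym.
have Bcl b : norm_closure B b -> b \o t = t \o b.
  move=> [bb bcl]; apply: approx_comm => //.
    by have [_] := (bounded_opP _).1 bt.
  by move=> e e0; have [c [_ ct _] bc] := bcl e e0; exists c.
apply: cstar_star_algebra; last first.
  move=> b clb; have [b' clb' bb'] := norm_closure_adjoint Bb Badj clb.
  split; [by case: clb | exact: Bcl | exists b'; split=> //; [by case: clb'|exact: Bcl]].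
split=> //.
- split; [exact: bounded_op_id | by apply/funext |].
  by exists idfun; split; [exact: bounded_op_id | | apply/funext].
- have linc k b c : b \o t = t \o b -> c \o t = t \o c ->
      (k *: b + c) \o t = t \o (k *: b + c).
    move=> bt' ct; apply/funext => x.
    rewrite -[LHS]/(k *: (b \o t) x + (c \o t) x) bt' ct.
    by rewrite -[RHS]/(t (k *: b x + c x)) lt.
  move=> k b c [bb bt' [b' [bb' adj b't]]] [bc ct [c' [bc' adj' c't]]]; split.
  + exact: bounded_op_lin.
  + exact: linc.
  + exists (k^* *: b' + c'); split; [exact: bounded_op_lin | | exact: linc].
    exact: is_adjoint_lin.
- have compc b c : b \o t = t \o b -> c \o t = t \o c ->
      (b \o c) \o t = t \o (b \o c).
    move=> bt' ct; apply/funext => x.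
    rewrite -[LHS]/(b ((c \o t) x)) ct -[LHS]/((b \o t) (c x)) bt'.
    by [].
  move=> b c [bb bt' [b' [bb' adj b't]]] [bc ct [c' [bc' adj' c't]]]; split.
  + exact: bounded_op_comp.
  + exact: compc.
  + exists (c' \o b'); split; [exact: bounded_op_comp | | exact: compc].
    exact: is_adjoint_comp.
Qed.

End OperatorAlgebras.

(** * Sectors and intertwiners *)

Section DoubleCones.
Variables (R : realType) (n : nat).
Local Notation M := (Defs.minkowski R n).
Implicit Types (x y z : M) (O S : set M).

Definition time_axis (t : R) : M := \row_j (if j == ord0 then t else 0).

Definition cone_around_origin (t : R) : set M :=
  [set z | chronological (time_axis (- t)) z /\ chronological z (time_axis t)].

Lemma double_cone_around_origin t : 0 < t -> double_cone (cone_around_origin t).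
Proof.
move=> t0; exists (time_axis (- t)), (time_axis t); split=> //.
rewrite /chronological /lorentz big1 => [|i _]; last first.
  by rewrite !mxE -[lift _ _ == _]/false oppr0 addr0 mulr0.
by rewrite !mxE eqxx; split; nra.
Qed.

Lemma double_cone_sub O : double_cone O -> exists t, forall s, t <= s ->
  O `<=` cone_around_origin s.
Proof.
move=> [x [y [_ ->]]]; pose h := y 0 ord0 - x 0 ord0.
pose X := \sum_(i < n.+1) x 0 (lift ord0 i) ^+ 2.
pose B := 2 * h ^+ 2 + 2 * X.
(* [B] bounds the squared spatial norm of the points of the cone. Both tips are then at time
   distance at least [B + 1] from any such point, and [(B + 1) ^+ 2 > B]. *)
exists (`|x 0 ord0| + `|h| + B + 1) => s ts z [].
rewrite /chronological /lorentz !mxE => -[zx0 zx] [yz0 yz].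
have X0 : 0 <= X by apply: sumr_ge0 => i _; rewrite sqr_ge0.
have zB : \sum_(i < n.+1) z 0 (lift ord0 i) ^+ 2 <= B.
  apply: (@le_trans _ _ (2 * (\sum_(i < n.+1)
     (z - x) 0 (lift ord0 i) * (z - x) 0 (lift ord0 i)) + 2 * X)).
    rewrite !mulr_sumr -big_split; apply: ler_sum => i _ /=; rewrite !mxE.
    by have := sqr_ge0 (z 0 (lift ord0 i) - 2 * x 0 (lift ord0 i)); lra.
  rewrite /B lerD2r ler_pM2l ?ltr0n //; rewrite /h.
  by nra.
have hx := ler_norm h; have xx := ler_norm (x 0 ord0).
have xx' := ler_norm (- x 0 ord0); rewrite normrN in xx'.
have h0 : 0 <= h ^+ 2 by rewrite sqr_ge0.
have B0 : 0 <= B by rewrite /B; lra.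
have [z1 z2] : B + 1 <= s + z 0 ord0 /\ B + 1 <= s - z 0 ord0.
  by rewrite /h in hx *; lra.
have sum1 : \sum_(i < n.+1) (z - time_axis (- s)) 0 (lift ord0 i) *
    (z - time_axis (- s)) 0 (lift ord0 i) = \sum_(i < n.+1) z 0 (lift ord0 i) ^+ 2.
  by apply: eq_bigr => i _; rewrite !mxE -[lift _ _ == _]/false subr0 expr2.
have sum2 : \sum_(i < n.+1) (time_axis s - z) 0 (lift ord0 i) *
    (time_axis s - z) 0 (lift ord0 i) = \sum_(i < n.+1) z 0 (lift ord0 i) ^+ 2.
  by apply: eq_bigr => i _; rewrite !mxE -[lift _ _ == _]/false sub0r mulrNN expr2.
by split; rewrite /chronological /lorentz ?sum1 ?sum2 !mxE eqxx; split; nra.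
Qed.

(** Directedness makes the union of the local algebras an algebra, and gives two endomorphisms a
    common localization region. *)
Lemma double_cone_directed O1 O2 : double_cone O1 -> double_cone O2 ->
  exists O, [/\ double_cone O, O1 `<=` O & O2 `<=` O].
Proof.
move=> /double_cone_sub[t1 h1] /double_cone_sub[t2 h2].
exists (cone_around_origin (Num.max 1 (Num.max t1 t2))); split.
- by apply: double_cone_around_origin; rewrite lt_max ltr01.
- by apply: h1; rewrite !le_max lexx orbT.
- by apply: h2; rewrite !le_max lexx !orbT.
Qed.

Lemma double_cone_image (g : M -> M) O : causal_transformation g ->
  double_cone O -> double_cone (g @` O).
Proof.
move=> [[h gK hK] gP] [x [y [xy ->]]]; exists (g x), (g y); split; first exact: (gP _ _).1.
apply/seteqP; split=> [_ [z [xz zy] <-]|z [xz zy]].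
  by split; apply: (gP _ _).1.
exists (h z); last exact: hK.
by split; [apply: (gP x (h z)).2 | apply: (gP (h z) y).2]; rewrite hK.
Qed.

Lemma causal_complementS O S : O `<=` S -> causal_complement S `<=` causal_complement O.
Proof. by move=> OS x xS y /OS; apply: xS. Qed.

End DoubleCones.

(** * Observables, localized endomorphisms and their intertwiners *)

Section Net.
Variables (R : realType) (n : nat) (A : haag_kastler R n).
Hypothesis duality : haag_duality A.
Local Notation C := R[i].
Local Notation M := (Defs.minkowski R n).
Local Notation H := (hk_space A).
Local Notation BH := (hsort H -> hsort H).
Local Notation net := (@hk_net R n A).
Local Notation obs := (observables net).
Local Notation T := (@intertwiners R n A).
Local Notation LT := (@localized_transportable R n A).
Implicit Types (a b s t : BH) (r : BH -> BH) (U : set M).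

Lemma local_star_algebra :
  star_algebra (\bigcup_(U in [set U | double_cone U]) net U).
Proof.
have vN U : double_cone U -> star_algebra (net U).
  by move=> dO; apply/von_neumann_star_algebra/hk_vN.
have common a b : (\bigcup_(U in [set U | double_cone U]) net U) a ->
    (\bigcup_(U in [set U | double_cone U]) net U) b ->
    exists2 U, double_cone U & net U a /\ net U b.
  move=> [U1 d1 a1] [U2 d2 b2]; have [U [dO O1O O2O]] := double_cone_directed d1 d2.
  by exists U => //; split; [apply: hk_isotony a1 | apply: hk_isotony b2].
split.
- by move=> a [U dO]; case: (vN U dO) => h _ _ _ _; apply: h.
- have dO : double_cone (@cone_around_origin R n 1).
    exact: double_cone_around_origin.
  by exists (cone_around_origin 1) => //; case: (vN _ dO).
- move=> k a b ua ub; have [U dO [Oa Ob]] := common a b ua ub; exists U => //.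
  by case: (vN _ dO) => _ _ h _ _; apply: h.
- move=> a b ua ub; have [U dO [Oa Ob]] := common a b ua ub; exists U => //.
  by case: (vN _ dO) => _ _ _ h _; apply: h.
- move=> a [U dO Oa]; case: (vN _ dO) => _ _ _ _ /(_ _ Oa)[b Ob ab].
  by exists b => //; exists U.
Qed.

Lemma obs_star_algebra : star_algebra obs.
Proof. exact: norm_closure_star_algebra local_star_algebra. Qed.

Lemma obs_bounded a : obs a -> bounded_op a.
Proof. by case: obs_star_algebra => h _ _ _ _ /h. Qed.
Lemma obs_linear a : obs a -> linear a.
Proof. by move=> /obs_bounded/bounded_op_linear. Qed.
Lemma obs_id : obs idfun.
Proof. by case: obs_star_algebra. Qed.
Lemma obs_lin (k : C) a b : obs a -> obs b -> obs (k *: a + b).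
Proof. by case: obs_star_algebra => _ _ h _ _; apply: h. Qed.
Lemma obs_comp a b : obs a -> obs b -> obs (a \o b).
Proof. by case: obs_star_algebra => _ _ _ h _; apply: h. Qed.
Lemma obs_adjoint a : obs a -> exists2 b, obs b & is_adjoint a b.
Proof. by case: obs_star_algebra => _ _ _ _ h; apply: h. Qed.

Lemma net_obs U a : double_cone U -> net U a -> obs a.
Proof.
move=> dO Oa; apply: sub_norm_closure; last by exists U.
by case: local_star_algebra.
Qed.

Lemma endo_obs r a : endomorphism r -> obs a -> obs (r a).
Proof. by case=> _; apply. Qed.
Lemma endo_id r : endomorphism r -> r idfun = idfun.
Proof. by case; case. Qed.
Lemma endo_comp r a b : endomorphism r -> obs a -> obs b -> r (a \o b) = r a \o r b.
Proof. by case; case=> _ _ _ h _ _; apply: h. Qed.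
Lemma endo_adjoint r a b : endomorphism r -> obs a -> obs b -> is_adjoint a b ->
  is_adjoint (r a) (r b).
Proof. by case; case=> _ _ _ _ h _; apply: h. Qed.

Lemma endomorphism_id : endomorphism (A := A) idfun.
Proof. by split=> //; split=> // a; apply: obs_bounded. Qed.

Lemma endomorphism_comp r1 r2 : endomorphism (A := A) r1 -> endomorphism (A := A) r2 ->
  endomorphism (A := A) (r1 \o r2).
Proof.
move=> e1 e2; split=> [|a oa]; last exact: endo_obs e1 (endo_obs e2 oa).
split=> [a oa||k a b oa ob|a b oa ob|a b oa ob ab] /=.
- exact: obs_bounded (endo_obs e1 (endo_obs e2 oa)).
- by rewrite !endo_id.
- case: (e2) => -[_ _ -> // _ _] _.
  by case: (e1) => -[_ _ h _ _] _; apply: h; [exact: endo_obs e2 oa | exact: endo_obs e2 ob].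
- by rewrite (endo_comp e2 oa ob) (endo_comp e1 (endo_obs e2 oa) (endo_obs e2 ob)).
- exact: endo_adjoint e1 (endo_obs e2 oa) (endo_obs e2 ob) (endo_adjoint e2 oa ob ab).
Qed.

Lemma localizedS r U1 U2 : U1 `<=` U2 -> localized (A := A) r U1 ->
  localized (A := A) r U2.
Proof.
move=> O12 l1 U a dO OO2; apply: l1 => //.
by apply: subset_trans OO2 _; apply: causal_complementS.
Qed.

(** Both endomorphisms fix the local algebras in the causal complement of a cone [U] containing both
    regions. So [t] commutes with these, and Haag duality places it in the von Neumann algebra of
    [U], which also contains its adjoint. *)
Lemma intertwiner_local r1 r2 t U1 U2 :
  double_cone U1 -> double_cone U2 ->
  localized (A := A) r1 U1 -> localized (A := A) r2 U2 -> bounded_op t ->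
  (forall a, obs a -> t \o r1 a = r2 a \o t) ->
  obs t /\ exists2 t', obs t' & is_adjoint t t'.
Proof.
move=> d1 d2 l1 l2 bt tr; have [U [dO O1O O2O]] := double_cone_directed d1 d2.
have {}l1 := localizedS O1O l1; have {}l2 := localizedS O2O l2.
have Ot : net U t.
  rewrite duality //; split=> // a; apply: commutant_generated => //.
  - by move=> b [Ub [db _]]; case: (hk_vN A db) => h _ _; apply: h.
  - move=> b [Ub [db Obsub] bb]; case: (hk_vN A db) => _ /(_ _ bb)[b' b'U bb'] _.
    by exists b' => //; exists Ub.
  - move=> b [Ub [db Obsub] bb]; have ob := net_obs db bb.
    by rewrite -[in LHS](l2 _ _ db Obsub bb) -tr // (l1 _ _ db Obsub bb).
split; first exact: net_obs Ot.
case: (hk_vN A dO) => _ /(_ _ Ot)[t' Ot' tt'] _.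
by exists t' => //; apply: net_obs Ot'.
Qed.

Lemma LT_endo r : LT r -> endomorphism r. Proof. by case. Qed.

Lemma LT_id : LT idfun.
Proof.
split; first exact: endomorphism_id.
have dO : double_cone (@cone_around_origin R n 1) by exact: double_cone_around_origin.
exists (cone_around_origin 1); split=> // g Gg; exists idfun; split=> //.
  exact: endomorphism_id.
exists idfun => //; split=> // y; by exists y.
Qed.

Lemma unitary_bounded (V : BH) : unitary_op V -> bounded_op V.
Proof.
move=> [lV dV _]; apply/bounded_opP; split=> //; exists 1; split=> // x.
by rewrite mul1r -(@ler_pXn2r _ 2) ?nnegrE // !hdotE dV.
Qed.

Lemma unitary_adjoint (V V' : BH) : unitary_op V -> is_adjoint V V' ->
  V' \o V = idfun /\ V \o V' = idfun.
Proof.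
move=> [lV dV sV] adj.
have V'V x : V' (V x) = x.
  by apply: hdot_ext => y; rewrite (is_adjoint_sym adj) dV.
split; apply/funext => x /=; first exact: V'V.
by have [y <-] := sV x; rewrite V'V.
Qed.

Lemma adjoint_unitary (V V' : BH) : linear V -> is_adjoint V V' ->
  V' \o V = idfun -> V \o V' = idfun -> unitary_op V.
Proof.
move=> lV adj V'V VV'; split=> // [x y|y].
  by rewrite adj -[V' (V y)]/((V' \o V) y) V'V.
by exists (V' y); rewrite -[V (V' y)]/((V \o V') y) VV'.
Qed.

Lemma LT_intertwiner r1 r2 t : LT r1 -> LT r2 -> bounded_op t ->
  (forall a, obs a -> t \o r1 a = r2 a \o t) ->
  obs t /\ exists2 t', obs t' & is_adjoint t t'.
Proof.
by move=> [_ [U1 [d1 l1 _]]] [_ [U2 [d2 l2 _]]]; apply: intertwiner_local l1 l2.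
Qed.

Lemma LT_comp r1 r2 : LT r1 -> LT r2 -> LT (r1 \o r2).
Proof.
move=> [e1 [U1 [d1 l1 t1]]] [e2 [U2 [d2 l2 t2]]].
have [U [dO O1O O2O]] := double_cone_directed d1 d2.
split; first exact: endomorphism_comp.
have lcomp p q S : localized (A := A) p S -> localized (A := A) q S ->
    localized (A := A) (p \o q) S.
  by move=> lp lq U' a dO' O'S Oa /=; rewrite (lq U') // (lp U').
exists U; split=> //.
  by apply: lcomp; [apply: localizedS l1 | apply: localizedS l2].
move=> g Gg; have [p [ep lp [V uV VE]]] := t1 g Gg.
have [q [eq_ lq [W uW WE]]] := t2 g Gg.
exists (p \o q); split; first exact: endomorphism_comp.
  by apply: lcomp; [apply: localizedS lp | apply: localizedS lq]; apply: image_subset.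
have dgO2 : double_cone (g @` U2).
  by apply: double_cone_image => //; case: (hk_group_causal A) => h _ _ _; apply: h.
(* The product is transported by [V \o r1 W]. The properties of [r1] concern observables only, so
   [W] must first be shown to be one. *)
have [oW [W' oW' WW']] := intertwiner_local d2 dgO2 l2 lq (unitary_bounded uW) WE.
have [W'W WW'1] := unitary_adjoint uW WW'.
have urW : unitary_op (r1 W).
  apply: (@adjoint_unitary _ (r1 W')).
  - exact/obs_linear/endo_obs.
  - exact: endo_adjoint.
  - by rewrite -endo_comp // W'W endo_id.
  - by rewrite -endo_comp // WW'1 endo_id.
exists (V \o r1 W).
  case: uV urW => lV dV sV [lW dW sW]; split.
  - by move=> k x y /=; rewrite lW lV.
  - by move=> x y /=; rewrite dV dW.
  - by move=> y; have [x <-] := sV y; have [z <-] := sW x; exists z.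
move=> a oa; have o2a := endo_obs e2 oa; have oqa := endo_obs eq_ oa.
rewrite -[LHS]/(V \o (r1 W \o r1 (r2 a))) -endo_comp // WE // endo_comp //.
by rewrite compA VE.
Qed.

Lemma intertwiner_obs r1 r2 t : T r1 r2 t -> obs t. Proof. by case. Qed.

Lemma intertwiner_lin r1 r2 (k : C) s t : LT r1 -> LT r2 ->
  T r1 r2 s -> T r1 r2 t -> T r1 r2 (k *: s + t).
Proof.
move=> [e1 _] [e2 _] [os sr] [ot tr]; split; first exact: obs_lin.
move=> a oa; apply/funext => x.
rewrite -[LHS]/(k *: (s \o r1 a) x + (t \o r1 a) x) sr // tr //.
have [l _] := obs_bounded (endo_obs e2 oa).
by rewrite -[RHS]/(r2 a (k *: s x + t x)) l.
Qed.

Lemma intertwiner0 r1 r2 : LT r2 -> T r1 r2 (fun=> 0).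
Proof.
move=> [e2 _]; split; last first.
  move=> a oa; apply/funext => x /=.
  by rewrite (linear_op0 (obs_linear (endo_obs e2 oa))).
have := obs_lin (-1) obs_id obs_id; congr obs; apply/funext => x.
by rewrite -[LHS]/(-1 *: x + x) scaleN1r addNr.
Qed.

Lemma intertwiner_comp r1 r2 r3 s t :
  T r2 r3 s -> T r1 r2 t -> T r1 r3 (s \o t).
Proof.
move=> [os sr] [ot tr]; split; first exact: obs_comp.
by move=> a oa; rewrite -[LHS]/(s \o (t \o r1 a)) tr // compA sr.
Qed.

Lemma intertwiner_id r : endomorphism (A := A) r -> T r r idfun.
Proof. by move=> e; split; [exact: obs_id | move=> a oa; apply/funext]. Qed.

Lemma intertwiner_adjoint r1 r2 t : LT r1 -> LT r2 -> T r1 r2 t ->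
  exists2 t', T r2 r1 t' & is_adjoint t t'.
Proof.
move=> L1 L2 [ot tr]; have e1 := LT_endo L1; have e2 := LT_endo L2.
have [_ [t' ot' tt']] := LT_intertwiner L1 L2 (obs_bounded ot) tr.
exists t' => //; split=> // a oa; have [b ob ab] := obs_adjoint oa.
have ba := is_adjoint_sym ab.
have := is_adjoint_comp tt' (endo_adjoint e1 ob oa ba).
rewrite tr // => /is_adjoint_uniq/(_ (is_adjoint_comp (endo_adjoint e2 ob oa ba) tt')).
by [].
Qed.

Lemma sector_irreducible r : LT r -> rep_irreducible obs r ->
  irreducible_family [set r a | a in obs].
Proof.
move=> Lr [_ irr] W W0 Wl Wc Winv; apply: irr => // a x oa Wx.
by apply: Winv => //; exists a.
Qed.

Lemma sector_schur r t : LT r -> rep_irreducible obs r -> T r r t ->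
  exists k : C, t = k *: idfun.
Proof.
move=> Lr irr Tt; have [t' Tt' tt'] := intertwiner_adjoint Lr Lr Tt.
have [|||||k kE] := @schur _ _ [set r a | a in obs] _ (sector_irreducible Lr irr) t t'.
- by move=> _ [a oa <-]; apply: obs_bounded; apply: endo_obs (LT_endo Lr) oa.
- exact: obs_bounded (intertwiner_obs Tt).
- exact: tt'.
- by move=> _ [a oa <-]; case: Tt => _ ->.
- by move=> _ [a oa <-]; case: Tt' => _ ->.
by exists k; apply/funext => v; rewrite kE.
Qed.

Lemma vacuum_neq0 : hk_vacuum A != 0.
Proof. by rewrite -normr_eq0 hk_vacuum_unit oner_eq0. Qed.

Lemma scalar_op_inj (k l : C) : k *: (idfun : BH) = l *: idfun -> k = l.
Proof.
move=> /(congr1 (@^~ (hk_vacuum A))) /= kl; apply/eqP; rewrite -subr_eq0.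
have : (k - l) *: hk_vacuum A = 0.
  by rewrite scalerBl -[k *: _]/((k *: idfun : BH) _) kl subrr.
by move=> /eqP; rewrite scaler_eq0 (negPf vacuum_neq0) orbF.
Qed.

(** By Schur's lemma [t' \o t] and [t \o t'] are scalars; for nonzero [t] they are equal and
    positive, and dividing [t] by the square root makes it unitary. *)
Lemma sector_intertwiner_equiv r1 r2 t : LT r1 -> LT r2 ->
  rep_irreducible obs r1 -> rep_irreducible obs r2 ->
  T r1 r2 t -> t != (fun=> 0) -> rep_equiv obs r1 r2.
Proof.
move=> L1 L2 i1 i2 Tt t0; have [t' Tt' tt'] := intertwiner_adjoint L1 L2 Tt.
have [k kE] := sector_schur L1 i1 (intertwiner_comp Tt' Tt).
have [l lE] := sector_schur L2 i2 (intertwiner_comp Tt Tt').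
have lt := obs_linear (intertwiner_obs Tt).
have ktt v : t' (t v) = k *: v by rewrite -[LHS]/((t' \o t) v) kE.
have ltt v : t (t' v) = l *: v by rewrite -[LHS]/((t \o t') v) lE.
have [v tv] : exists v, t v != 0.
  apply: contra_notP (elimN eqP t0) => z; apply/funext => v.
  by apply/eqP; apply: contra_notT z => ?; exists v.
have kl : k = l.
  apply/eqP; rewrite -subr_eq0.
  have : (k - l) *: t v = 0.
    by rewrite scalerBl -ltt ktt (linear_opZ _ _ lt) subrr.
  by move=> /eqP; rewrite scaler_eq0 (negPf tv) orbF.
have k_gt0 : 0 < k.
  have v0 : v != 0 by apply: contraNneq tv => ->; rewrite (linear_op0 lt).
  have : 0 < k * hdot v v.
    by rewrite -hdotZl -ktt (is_adjoint_sym tt') -hdotE exprn_gt0 // normr_gt0.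
  by rewrite pmulr_lgt0 // -hdotE exprn_gt0 // normr_gt0.
pose q := (sqrtC k)^-1; have q0 : 0 < q by rewrite invr_gt0 sqrtC_gt0.
have qq : q * q * k = 1.
  by rewrite -[in _ * k](sqrtCK k) expr2 mulrACA mulVf ?mulr1 // gt_eqF ?sqrtC_gt0.
have qr : q^* = q by apply/CrealP/ger0_real/ltW.
exists (fun v => q *: t v).
  split=> [c x y|x y|y].
  - by rewrite lt scalerDr !scalerA mulrC.
  - rewrite hdotZl hdotZr qr tt' ktt hdotZr.
    have -> : k^* = k by apply/CrealP/ger0_real/ltW.
    by rewrite !mulrA qq mul1r.
  - exists (q *: t' y); rewrite (linear_opZ _ _ lt) ltt -kl !scalerA !mulrA qq.
    by rewrite scale1r.
move=> a oa; apply/funext => x /=.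
rewrite (linear_opZ _ _ (obs_linear (endo_obs (LT_endo L2) oa))).
by case: Tt => _ /(_ a oa)/(congr1 (@^~ x)) /= ->.
Qed.

(** * Left inverses and the dimension of intertwiner spaces *)

Section LeftInverse.
Variables (r q : BH -> BH) (Phi : BH -> BH).
Hypotheses (Lr : LT r) (Lq : LT q) (Phi_inv : Defs.left_inverse (A := A) r Phi).

Lemma left_inverse_obs a : obs a -> obs (Phi a).
Proof. by case: Phi_inv => h _ _ _ _; apply: h. Qed.

Lemma left_inverse_linear (k : C) a b : obs a -> obs b ->
  Phi (k *: a + b) = k *: Phi a + Phi b.
Proof. by case: Phi_inv => _ h _ _ _; apply: h. Qed.

Lemma left_inverse_positive a : obs a -> positive_op a -> positive_op (Phi a).
Proof. by case: Phi_inv => _ _ h _ _; apply: h. Qed.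

Lemma left_inverse_id : Phi idfun = idfun.
Proof. by case: Phi_inv. Qed.

Lemma left_inverse_bimodule a b c : obs a -> obs b -> obs c ->
  Phi ((r a \o b) \o r c) = (a \o Phi b) \o c.
Proof. by case: Phi_inv => _ _ _ _ h; apply: h. Qed.

(** The bimodule property moves [q a] out of [Phi] on either side of [s]. The result is a
    self-intertwiner of [q], to which Schur's lemma applies when [q] is irreducible. *)
Lemma left_inverse_intertwiner s : T (r \o q) (r \o q) s -> T q q (Phi s).
Proof.
move=> [os sr]; split; first exact: left_inverse_obs.
move=> a oa; have oqa := endo_obs (LT_endo Lq) oa.
have := left_inverse_bimodule obs_id os oqa.
have := left_inverse_bimodule oqa os obs_id.
rewrite (endo_id (LT_endo Lr)) -[_ \o idfun]/(r (q a) \o s) -[idfun \o s]/s.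
have := sr a oa; rewrite /= => -> -> <-.
by [].
Qed.

End LeftInverse.

Section FusionSpace.
Variable eps : (BH -> BH) -> (BH -> BH) -> BH.
Hypothesis eps_stat : statistics_operators eps.

Lemma statistics_unitary r q : LT r -> LT q -> unitary_op (eps r q).
Proof. by case: eps_stat => h _ _ _ _ Lr Lq; case: (h r q Lr Lq). Qed.

Lemma statistics_intertwiner r q : LT r -> LT q ->
  T (r \o q) (q \o r) (eps r q).
Proof. by case: eps_stat => h _ _ _ _ Lr Lq; case: (h r q Lr Lq). Qed.

(** Naturality in the second argument, with [eps r (r \o q)] expanded. It exhibits [eps r r] between
    two images under [r], from which a left inverse can extract it. *)
Lemma statistics_natural r q p t : LT r -> LT q -> LT p ->
  T p (r \o q) t ->
  (r (eps r q) \o eps r r) \o r t = t \o eps r p.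
Proof.
case: eps_stat => _ nat _ hex _ Lr Lq Lp Tt; have Lrq := LT_comp Lr Lq.
have := nat r (r \o q) r p idfun t Lr Lrq Lr Lp (intertwiner_id (LT_endo Lr)) Tt.
rewrite hex // (endo_id (LT_endo Lp)).
by [].
Qed.

Variables (r q p : BH -> BH) (Phi : BH -> BH).
Hypotheses (Lr : LT r) (Lq : LT q) (Lp : LT p) (Phi_inv : Defs.left_inverse (A := A) r Phi).
Hypotheses (iq : rep_irreducible obs q) (ip : rep_irreducible obs p).

(* A Pimsner-Popa type bound for the left inverse: naturality of the statistics
   operators gives [lambda *: u t' = Phi (t' eps)], and the Cauchy-Schwarz inequality
   for the positive functional [hdot (Phi _ x) x] then bounds [kappa] below. *)
Lemma left_inverse_lower_bound (lambda kappa : C) t t' :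
  Phi (eps r r) = lambda *: idfun -> T (r \o q) p t -> T p (r \o q) t' ->
  is_adjoint t t' -> t \o t' = idfun -> Phi (t' \o t) = kappa *: idfun ->
  `|lambda| ^+ 2 <= 16 * kappa.
Proof.
move=> lE Tt Tt' adj tt' kE.
have [ot _] := Tt; have [ot' _] := Tt'.
have Lrq := LT_comp Lr Lq; have Lpr := LT_comp Lp Lr; have Lrp := LT_comp Lr Lp.
pose u := eps r q; pose w := eps r p.
have [ou _] := statistics_intertwiner Lr Lq.
have [oe _] := statistics_intertwiner Lr Lr.
have Tw := statistics_intertwiner Lr Lp; have [ow _] := Tw.
have [w' [ow' _] ww'] := intertwiner_adjoint Lrp Lpr Tw.
have [_ w'K] := unitary_adjoint (statistics_unitary Lr Lp) ww'.
pose Y := t' \o w; pose Y' := w' \o t.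
have oY : obs Y by apply: obs_comp.
have oY' : obs Y' by apply: obs_comp.
have YY' : is_adjoint Y' Y.
  exact: is_adjoint_comp (is_adjoint_sym ww') adj.
have PhiY : Phi Y = lambda *: (u \o t').
  rewrite /Y -(statistics_natural Lr Lq Lp Tt') left_inverse_bimodule // lE.
  apply/funext => x; rewrite -[LHS]/(eps r q (lambda *: t' x)).
  by rewrite (linear_opZ _ _ (obs_linear ou)).
have oE : obs (t' \o t) by apply: obs_comp.
have YYE : Y \o Y' = t' \o t.
  by rewrite -[LHS]/(t' \o ((w \o w') \o t)) w'K.
(* The expression [hdot (Phi (Z' \o Z) x) x] is nonnegative for every [z]; its discriminant is the
   inequality sought. *)
have bound x : `|lambda * hdot (u (t' x)) x| ^+ 2 <= (kappa * hdot x x) * hdot x x.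
  apply: (@sesqui_discriminant _ _ _ (hdot (Phi Y' x) x)) => z.
  pose Z := z *: idfun + Y'; pose Z' := z^* *: idfun + Y.
  have ZZ' : is_adjoint Z Z' by apply: is_adjoint_lin.
  have oZ : obs Z by apply: obs_lin => //; apply: obs_id.
  have oZ' : obs Z' by apply: obs_lin => //; apply: obs_id.
  have Zpos : positive_op (Z' \o Z).
    by move=> y; rewrite /= (is_adjoint_sym ZZ') hdot_ge0.
  have lY := obs_linear oY.
  have ZZE : Z' \o Z = (z * z^*) *: idfun + (z^* *: Y' + (z *: Y + (t' \o t))).
    apply/funext => y; rewrite -YYE.
    rewrite -[RHS]/((z * z^*) *: y + (z^* *: Y' y + (z *: Y y + Y (Y' y)))).
    rewrite -[LHS]/(z^* *: (z *: y + Y' y) + Y (z *: y + Y' y)).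
    rewrite (linear_opD _ _ lY) (linear_opZ _ _ lY) scalerDr scalerA mulrC.
    by rewrite -!addrA.
  have := left_inverse_positive Phi_inv (obs_comp oZ' oZ) Zpos x.
  have o1 := obs_lin z oY oE; have o2 := obs_lin z^* oY' o1.
  rewrite ZZE (left_inverse_linear Phi_inv _ obs_id o2).
  rewrite (left_inverse_linear Phi_inv _ oY' o1).
  rewrite (left_inverse_linear Phi_inv _ oY oE) (left_inverse_id Phi_inv) kE PhiY.
  rewrite -[(_ + _) x]/((z * z^*) *: x + (z^* *: Phi Y' x +
    (z *: (lambda *: u (t' x)) + kappa *: x))).
  rewrite !hdotDl !hdotZl; congr (_ <= _); ring.
have lu' : linear (u \o t').
  by apply/obs_linear/obs_comp.
have du' x y : hdot ((u \o t') x) ((u \o t') y) = hdot x y.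
  have [_ du _] := statistics_unitary Lr Lq.
  by rewrite /= du -adj -[t (t' x)]/((t \o t') x) tt'.
(* [u \o t'] is an isometry. Norm at most 2 means [hdot x x <= 4], and the two such factors in
   [bound] produce 16. *)
have [x x2 fx] := isometry_numerical_radius lu' du' (hk_vacuum_unit A).
have kappa_ge0 : 0 <= kappa.
  have := left_inverse_positive Phi_inv oE _ (hk_vacuum A); rewrite kE.
  rewrite -[(kappa *: idfun : BH) _]/(kappa *: hk_vacuum A) hdotZl -hdotE.
  rewrite hk_vacuum_unit expr1n mulr1; apply.
  by move=> y; rewrite /= (is_adjoint_sym adj) hdot_ge0.
have x4 : hdot x x <= 4.
  rewrite -hdotE (_ : 4 = 2 ^+ 2); last by ring.
  by rewrite ler_pXn2r ?nnegrE.
apply: le_trans (_ : `|lambda * hdot (u (t' x)) x| ^+ 2 <= _).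
  by rewrite normrM exprMn ler_peMr ?exprn_ge0 // exprn_ege1.
apply: le_trans (bound x) _; rewrite -mulrA mulrC ler_wpM2r //.
rewrite (_ : 16 = 4 * 4); last by ring.
by apply: ler_pM => //; apply: hdot_ge0.
Qed.

Lemma sum_op (N : nat) (F : 'I_N -> BH) x : (\sum_i F i) x = \sum_i F i x.
Proof. by rewrite fct_sumE. Qed.

Lemma obs_sum (N : nat) (F : 'I_N -> BH) : (forall i, obs (F i)) -> obs (\sum_i F i).
Proof.
move=> oF; apply: big_ind => [|a b oa ob|i _]; last exact: oF.
  have := obs_lin (-1) obs_id obs_id; congr obs.
  by rewrite scaleN1r addNr.
by rewrite -[a]scale1r; apply: obs_lin.
Qed.

Lemma left_inverse_sum (N : nat) (F : 'I_N -> BH) : (forall i, obs (F i)) ->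
  Phi (\sum_i F i) = \sum_i Phi (F i).
Proof.
move=> oF.
suff [_ //] : obs (\sum_i F i) /\ Phi (\sum_i F i) = \sum_i Phi (F i).
apply: (big_ind2 (fun a b => obs a /\ Phi a = b)) => [|a a' b b' [oa <-] [ob <-]|i _].
- have o1 := obs_id; have := obs_lin (-1) o1 o1.
  have := left_inverse_linear Phi_inv (-1) o1 o1.
  by rewrite (left_inverse_id Phi_inv) scaleN1r addNr.
- by rewrite -[a]scale1r (left_inverse_linear Phi_inv _ oa ob) !scale1r; split=> //;
    rewrite -[a]scale1r; apply: obs_lin.
- by split.
Qed.

(** The [F' i] are isometries with mutually orthogonal ranges, and the [F' i \o F i] are the range
    projections. *)
Definition orthonormal_family (N : nat) (F F' : 'I_N -> BH) : Prop :=
  [/\ forall i, T (r \o q) p (F i), forall i, T p (r \o q) (F' i),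
      forall i, is_adjoint (F i) (F' i) &
      forall i j, F i \o F' j = (i == j)%:R *: idfun].

Lemma orthonormal_family_bound (lambda : C) (N : nat) (F F' : 'I_N -> BH) :
  Phi (eps r r) = lambda *: idfun -> orthonormal_family F F' ->
  N%:R * `|lambda| ^+ 2 <= 16.
Proof.
move=> lE [TF TF' adj FF'].
have TE i : T (r \o q) (r \o q) (F' i \o F i) by apply: intertwiner_comp (TF' i) (TF i).
have /choice[kappa kE] i : exists k : C, Phi (F' i \o F i) = k *: idfun.
  by apply: (sector_schur Lq iq); apply: left_inverse_intertwiner (TE i).
have kge i : `|lambda| ^+ 2 <= 16 * kappa i.
  apply: left_inverse_lower_bound lE (TF i) (TF' i) (adj i) _ (kE i).
  by rewrite FF' eqxx scale1r.
suff ksum : \sum_i kappa i <= 1.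
  apply: (@le_trans _ _ (\sum_(i < N) (16 * kappa i))).
    by rewrite mulr_natl -[N in _ *+ N]card_ord -sumr_const; apply: ler_sum.
  by rewrite -mulr_sumr -[leRHS]mulr1 ler_wpM2l.
pose P := \sum_i (F' i \o F i).
have oP : obs P by apply: obs_sum => i; case: (TE i).
have PE x : P x = \sum_i F' i (F i x) by rewrite /P sum_op.
have P_sa : is_adjoint P P.
  move=> x y; rewrite !PE linear_sumlz linear_sumr; apply: eq_bigr => i _ /=.
  by rewrite (is_adjoint_sym (adj i)) (adj i).
have PP x : P (P x) = P x.
  rewrite PE [RHS]PE; apply: eq_bigr => i _; congr (F' i _).
  rewrite PE; have [lF _] := obs_bounded (intertwiner_obs (TF i)).
  have Fsum (G : 'I_N -> H) : F i (\sum_j G j) = \sum_j F i (G j).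
    by apply: (big_morph (F i)) => [y z|]; [exact: linear_opD | exact: linear_op0].
  rewrite Fsum (bigD1 i) //= big1 ?addr0 => [|j ji].
    by rewrite -[LHS]/((F i \o F' i) (F i x)) FF' eqxx scale1r.
  by rewrite -[LHS]/((F i \o F' j) (F j x)) FF' eq_sym (negPf ji) scale0r.
have lP := obs_linear oP.
(* [1 - P] is an orthogonal projection. Positivity of [Phi] on it, evaluated at the vacuum vector,
   bounds the sum of the [kappa i]. *)
have pos : positive_op ((-1 : C) *: P + idfun).
  move=> x; rewrite -[(_ + _) x]/((-1) *: P x + x) scaleN1r addrC.
  have -> : hdot (x - P x) x = hdot (x - P x) (x - P x).
    rewrite [RHS]hdotBr -P_sa (linear_opB _ _ lP) PP subrr hdot0l.
    by rewrite subr0.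
  exact: hdot_ge0.
have := left_inverse_positive Phi_inv (obs_lin (-1) oP obs_id) pos (hk_vacuum A).
rewrite (left_inverse_linear Phi_inv _ oP obs_id) (left_inverse_id Phi_inv).
rewrite left_inverse_sum => [|i]; last by case: (TE i).
rewrite -[(_ + _) _]/((-1) *: (\sum_i Phi (F' i \o F i)) (hk_vacuum A) + hk_vacuum A).
rewrite sum_op (eq_bigr (fun i => kappa i *: hk_vacuum A)); last by move=> i _; rewrite kE.
rewrite -scaler_suml scaleN1r hdotDl hdotNl hdotZl -hdotE hk_vacuum_unit expr1n mulr1.
by rewrite addrC subr_ge0.
Qed.

(** A family that cannot be lengthened is a basis. Subtract from [v] its components along the
    family: the remainder [w] is orthogonal to it and [w \o w'] is a scalar [k >= 0]. If [k > 0], a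
    multiple of [w] could be appended; if [k = 0], then [w = 0]. *)
Lemma fusion_space_has_dim (lambda : C) : lambda != 0 ->
  Phi (eps r r) = lambda *: idfun -> exists N, has_dim (T (r \o q) p) N.
Proof.
move=> l0 lE; have Lrq := LT_comp Lr Lq.
have [N [F [F' [fam nmax]]]] : exists N F F', @orthonormal_family N F F' /\
    ~ exists G G', @orthonormal_family N.+1 G G'.
  apply: contrapT => nex.
  have all N : exists F F', @orthonormal_family N F F'.
    elim: N => [|N [F [F' fam]]].
      by exists (fun=> idfun), (fun=> idfun); split=> -[].
    by apply: contrapT => n1; apply: nex; exists N, F, F'.
  (* Any number above 16 would serve: a long enough family gives [17 <= N.+1 * |lambda|^2], against
     the bound 16. *)
  have l2 : 0 < `|lambda| ^+ 2 / 17 by rewrite divr_gt0 ?exprn_gt0 ?normr_gt0.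
  have [N /(_ N (leqnn N))] := inv_nat_small l2.
  have N0 : 0 < N%:R + 1 :> C by rewrite ltr_wpDl.
  rewrite ler_pdivlMr // mulrC ler_pdivrMr // => N17.
  have [F [F' fam]] := all N.+1; have := orthonormal_family_bound lE fam.
  rewrite -natr1 mulrC => /(le_trans N17); rewrite ler_nat.
  by [].
case: (fam) => TF TF' adj FF'.
have famcomp (c : {ffun 'I_N -> C}) j : (\sum_i c i *: F i) \o F' j = c j *: idfun.
  apply/funext => x; rewrite -[LHS]/((\sum_i c i *: F i) (F' j x)) sum_op.
  rewrite (bigD1 j) //= big1 ?addr0 => [|i ij].
    by rewrite -[LHS]/(c j *: (F j \o F' j) x) FF' eqxx scale1r.
  by rewrite -[LHS]/(c i *: (F i \o F' j) x) FF' (negPf ij) scale0r scaler0.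
exists N, F => // v Tv.
have /choice[c cE] j : exists k : C, v \o F' j = k *: idfun.
  by apply: (sector_schur Lp ip); apply: intertwiner_comp Tv (TF' j).
exists [ffun i => c i]; split; last first.
  move=> c' vE; apply/ffunP => j; rewrite ffunE; apply: scalar_op_inj.
  by rewrite -cE vE famcomp.
set c0 := [ffun i => c i].
pose w := (-1 : C) *: (\sum_i c0 i *: F i) + v.
have Tsum : T (r \o q) p (\sum_i c0 i *: F i).
  apply: big_ind => [|a b Ta Tb|i _].
  - exact: intertwiner0.
  - by rewrite -[a]scale1r; apply: intertwiner_lin.
  - rewrite -[_ *: _]addr0; apply: intertwiner_lin => //; exact: intertwiner0.
have Tw : T (r \o q) p w by apply: intertwiner_lin.
have wF j : w \o F' j = fun=> 0.
  apply/funext => x.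
  rewrite -[LHS]/((-1) *: ((\sum_i c0 i *: F i) \o F' j) x + (v \o F' j) x).
  by rewrite famcomp cE ffunE scaleN1r addNr.
have [w' Tw' ww'] := intertwiner_adjoint Lrq Lp Tw.
have Fw j : F j \o w' = fun=> 0.
  apply: (is_adjoint_uniq (is_adjoint_comp ww' (is_adjoint_sym (adj j)))).
  rewrite wF => x y; by rewrite hdot0l hdot0r.
have [k kE] := sector_schur Lp ip (intertwiner_comp Tw Tw').
have wwk x : hdot (w' x) (w' x) = k * hdot x x.
  by rewrite -ww' -[w (w' x)]/((w \o w') x) kE hdotZl.
have [k0|k_neq0] := eqVneq k 0.
  have w'0 x : w' x = 0.
    by apply/eqP; rewrite -normr_eq0 -sqrf_eq0 hdotE wwk k0 mul0r.
  apply/funext => x; apply/eqP; rewrite -subr_eq0; apply/eqP.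
  have -> : v x - (\sum_i c0 i *: F i) x = w x.
    by rewrite -[w x]/((-1) *: (\sum_i c0 i *: F i) x + v x) scaleN1r addrC.
  by apply: hdot_ext => y; rewrite ww' w'0 hdot0l hdot0r.
have k_gt0 : 0 < k.
  rewrite lt_def k_neq0 /= -[k]mulr1 -[1](expr1n _ 2) -(hk_vacuum_unit A) hdotE.
  by rewrite -wwk hdot_ge0.
exfalso; apply: nmax.
pose l := (sqrtC k)^-1; have l_gt0 : 0 < l by rewrite invr_gt0 sqrtC_gt0.
have ll : l * l * k = 1.
  by rewrite -[in _ * k](sqrtCK k) expr2 mulrACA mulVf ?mulr1 // gt_eqF ?sqrtC_gt0.
have lr : l^* = l by apply/CrealP/ger0_real/ltW.
have scT r1 r2 s : LT r1 -> LT r2 -> T r1 r2 s -> T r1 r2 (l *: s).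
  move=> L1 L2 Ts; rewrite -[_ *: _]addr0; apply: intertwiner_lin => //.
  exact: intertwiner0.
have lw := obs_linear (intertwiner_obs Tw).
exists (fun i => if unlift ord_max i is Some j then F j else l *: w).
exists (fun i => if unlift ord_max i is Some j then F' j else l *: w').
split=> [i|i|i|i j].
- by case: unliftP => [j _|_]; [exact: TF | exact: scT].
- by case: unliftP => [j _|_]; [exact: TF' | exact: scT].
- case: unliftP => [j _|_]; first exact: adj.
  by move=> x y; rewrite [LHS]hdotZl [RHS]hdotZr lr ww'.
case: (unliftP ord_max i) => [i' ->|->]; case: (unliftP ord_max j) => [j' ->|->].
- by rewrite FF' (inj_eq lift_inj).
- rewrite eq_sym (negPf (neq_lift _ _)) scale0r; apply/funext => x.
  rewrite -[LHS]/(F i' (l *: w' x)) (linear_opZ _ _ (obs_linear (intertwiner_obs (TF i')))).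
  by rewrite -[F i' _]/((F i' \o w') x) Fw scaler0.
- rewrite (negPf (neq_lift _ _)) scale0r; apply/funext => x.
  by rewrite -[LHS]/(l *: (w \o F' j') x) wF scaler0.
- rewrite eqxx scale1r; apply/funext => x.
  rewrite -[LHS]/(l *: w (l *: w' x)) (linear_opZ _ _ lw) -[w (w' x)]/((w \o w') x) kE.
  by rewrite -[(k *: idfun : BH) x]/(k *: x) !scalerA !mulrA ll scale1r.
Qed.

End FusionSpace.

(** * Fusion rules of finite sectors and of the vacuum *)

Section Fusion.
Variable eps : (BH -> BH) -> (BH -> BH) -> BH.
Hypothesis eps_stat : statistics_operators eps.

(** The scalar [lambda] is the value of [Phi (eps r r)], a self-intertwiner of the irreducible [r];
    finite statistics says that it is nonzero. *)
Lemma finite_sector_has_dim r q p : finite_sector eps r -> finite_sector eps q ->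
  finite_sector eps p -> exists N, has_dim (T (r \o q) p) N.
Proof.
move=> [Lr _ ir [Phi Phi_inv Phi0]] [Lq _ iq _] [Lp _ ip _].
have Te := statistics_intertwiner eps_stat Lr Lr.
have [l lE] := sector_schur Lr ir (left_inverse_intertwiner Lr Lr Phi_inv Te).
apply: (fusion_space_has_dim eps_stat Lr Lq Lp Phi_inv iq ip _ lE).
by apply: contra_notN Phi0 => /eqP l0; rewrite lE l0 scale0r.
Qed.

(* The observables act irreducibly since they contain the image of [r], which does. *)
Lemma vacuum_finite_sector r : finite_sector eps r -> finite_sector eps idfun.
Proof.
move=> [Lr _ [_ irr] _]; split.
- exact: LT_id.
- split; first by case: endomorphism_id.
    exists (@hk_rep R n A); split=> //; [exact: hk_rep_unitary | exact: hk_spectrum].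
  by move=> U _; exists idfun => //; split=> // y; exists y.
- split; first by exists (hk_vacuum A); apply: vacuum_neq0.
  move=> W W0 Wl Wc Winv; apply: irr => // a x oa Wx.
  exact: Winv (endo_obs (LT_endo Lr) oa) Wx.
(* The identity is its own left inverse, and a statistics operator is unitary, hence nonzero. *)
- exists idfun; first by split.
  move=> e0; have [_ du _] := statistics_unitary eps_stat LT_id LT_id.
  have := du (hk_vacuum A) (hk_vacuum A); rewrite [eps _ _]e0 hdot0l => /esym/eqP.
  by rewrite -hdotE hk_vacuum_unit expr1n oner_eq0.
Qed.

(** Composition with [s'] identifies the intertwiners out of [d] with those out of [rho J], where
    Schur's lemma leaves scalars or nothing. A general [d] is allowed because the lemma is meant for
    products with the vacuum sector. *)
Lemma equiv_sector_has_dim (I : finType) (rho : I -> BH -> BH) (J K : I)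
    (d : BH -> BH) s s' :
  sector_labelling eps rho -> T d (rho J) s -> T (rho J) d s' ->
  s \o s' = idfun -> s' \o s = idfun -> has_dim (T d (rho K)) (J == K).
Proof.
move=> [fin inj _] Ts Ts' ss' s's.
have [LJ _ iJ _] := fin J; have [LK _ iK _] := fin K.
have tE t : t = (t \o s') \o s by rewrite -compA s's.
case: eqVneq => [JK|JK]; last first.
  exists (fun=> idfun) => [[]//|t Tt]; exists [ffun=> 0]; split; last first.
    by move=> c _; apply/ffunP => -[].
  rewrite big_ord0; have [t0|t0] := eqVneq (t \o s') (fun=> 0).
    by rewrite (tE t) t0.
  by case/eqP: JK; apply/inj/(sector_intertwiner_equiv LJ LK iJ iK _ t0);
    apply: intertwiner_comp Tt Ts'.
subst K; exists (fun=> s) => // t Tt.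
have [k kE] := sector_schur LJ iJ (intertwiner_comp Tt Ts').
exists [ffun=> k]; split.
  by rewrite big_ord1 ffunE {1}(tE t) kE.
move=> c tc; apply/ffunP => i; rewrite ord1 ffunE; apply: scalar_op_inj.
by rewrite -kE tc big_ord1 -ss'.
Qed.

(** The labelled vacuum [rho z] is only equivalent to the identity, through a unitary [V]. Its
    inverse [V'] carries [rho z \o rho J] to [rho J], and [rho J V'] does so for
    [rho J \o rho z]. *)
Lemma vacuum_fusion_rules (I : finType) (rho : I -> BH -> BH) :
  sector_labelling eps rho -> (exists J : I, True) ->
  exists o, forall J K, has_dim (T (rho o \o rho J) (rho K)) (J == K) /\
                        has_dim (T (rho J \o rho o) (rho K)) (J == K).
Proof.
move=> lab [J0 _]; have [fin inj surj] := lab.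
have [z [V uV VE]] := surj _ (vacuum_finite_sector (fin J0)).
have Lz : LT (rho z) by case: (fin z).
have Vb := unitary_bounded uV.
have [Vo _] := LT_intertwiner LT_id Lz Vb VE.
have TV : T idfun (rho z) V by [].
have [V' TV' VV'] := intertwiner_adjoint LT_id Lz TV.
have [V'V VV'1] := unitary_adjoint uV VV'.
have [V'o V'E] := TV'.
exists z => J K; have LJ : LT (rho J) by case: (fin J).
have eJ := LT_endo LJ; split.
  apply: (equiv_sector_has_dim K (s := V') (s' := V) lab) => //.
    by split=> // a oa; apply: V'E (endo_obs eJ oa).
  by split=> // a oa; apply: VE (endo_obs eJ oa).
have oJV := endo_obs eJ Vo; have oJV' := endo_obs eJ V'o.
apply: (equiv_sector_has_dim K (s := rho J V') (s' := rho J V) lab).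
- split=> // a oa; have ooa := endo_obs (LT_endo Lz) oa.
  by rewrite /= -endo_comp // V'E // endo_comp.
- split=> // a oa; have ooa := endo_obs (LT_endo Lz) oa.
  by rewrite /= -[LHS]endo_comp // VE // endo_comp.
- by rewrite -endo_comp // V'V endo_id.
- by rewrite -endo_comp // VV'1 endo_id.
Qed.

End Fusion.
End Net.

Theorem theorem2 (R : realType) (n : nat) (A : haag_kastler R n)
    (duality : haag_duality A)
    (eps : ((hk_space A -> hk_space A) -> (hk_space A -> hk_space A)) ->
           ((hk_space A -> hk_space A) -> (hk_space A -> hk_space A)) ->
           (hk_space A -> hk_space A))
    (eps_stat : statistics_operators eps)
    (I : finType)
    (rho : I -> (hk_space A -> hk_space A) -> (hk_space A -> hk_space A))
    (rho_label : sector_labelling eps rho) :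
  exists G : bistar_algebra R[i], semisimple G /\
  exists (m : I -> nat) (tau : forall J : I, G -> 'M[R[i]]_(m J)),
    [/\ forall J, [/\ mx_rep (tau J), mx_rep_irreducible (tau J) &
                      mx_rep_unitary (tau J)],
        forall J K, mx_rep_equiv (tau J) (tau K) -> J = K,
        forall k (sigma : G -> 'M[R[i]]_k),
          mx_rep sigma -> mx_rep_irreducible sigma ->
          exists J, mx_rep_equiv sigma (tau J) &
        forall J1 J2 K, exists N : nat,
          has_dim (intertwiners (rho J1 \o rho J2) (rho K)) N /\
          has_dim (clebsch_gordan (tau J1) (tau J2) (tau K)) N].
Proof.
have [Iinh|I0] := pselect (exists J : I, True); last first.
  have {}I0 (J : I) : False by apply: I0; exists J.
  have [G [ssG noirr]] := exists_empty_bistar R[i] I0.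
  exists G; split=> //; exists (fun=> 0%N), (fun J _ => 0); split.
  - by move=> J; case: (I0 J).
  - by move=> J; case: (I0 J).
  - by move=> k sigma sr si; case: (noirr k sigma sr si).
  - by move=> J; case: (I0 J).
have [z zE] := vacuum_fusion_rules duality eps_stat rho_label Iinh.
have fin J : finite_sector eps (rho J) by case: rho_label.
(* The vacuum rules must hold as equations between the chosen numbers. Triples with a vacuum factor
   thus take their value from [vacuum_fusion_rules], the others from finite dimensionality. *)
have /choice[N NE] (t : I * I * I) : exists N : nat,
    [/\ has_dim (intertwiners (rho t.1.1 \o rho t.1.2) (rho t.2)) N,
        t.1.1 = z -> N = (t.1.2 == t.2) & t.1.2 = z -> N = (t.1.1 == t.2)].
  case: t => -[J1 J2] K /=.
  have [->|J1z] := eqVneq J1 z.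
    by exists (J2 == K); split=> // [|->//]; have [] := zE J2 K.
  have [->|J2z] := eqVneq J2 z.
    by exists (J1 == K); split=> // [|J1E]; [have [] := zE J1 K | rewrite J1E eqxx in J1z].
  have [N hN] := finite_sector_has_dim duality eps_stat (fin J1) (fin J2) (fin K).
  by exists N; split=> // E; [rewrite E eqxx in J1z | rewrite E eqxx in J2z].
have [J K|J K|G [ssG [m [tau [h1 h2 h3 h4]]]]] :=
    @exists_fusion_bistar R[i] I z (fun J1 J2 K => N (J1, J2, K)).
- by have [_ + _] := NE (z, J, K); apply.
- by have [_ _ +] := NE (J, z, K); apply.
exists G; split=> //; exists m, tau; split=> // J1 J2 K.
by exists (N (J1, J2, K)); split; [have [] := NE (J1, J2, K) | exact: h4].
Qed.
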